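(* Let $\mathcal M=(M,<,\ldots)$ be a locally l-visceral structure with property (d), property (B) and the $*$-continuity property. Then, for nonempty definable sets $X$: (1) if $f:X\to M^n$ is definable and $\mathcal D(f)$ is the set of points of $X$ at which $f$ is discontinuous, then $\dim\mathcal D(f)<\dim X$; (2) $\dim(\operatorname{cl}(X)\setminus X)<\dim X$; (3) $\dim X=d$ if and only if $d$ is the maximum of the nonnegative integers $e$ for which there exist an open box $B\subseteq M^e$ and a definable injective continuous map $\varphi:B\to X$ that is a homeomorphism onto its image; (4) if $X\subseteq M^n$, there is a point $x\in X$ such that $\dim(X\cap B)=\dim X$ for every open box $B$ containing $x$.
   Context: $\mathcal M$ is an expansion of a dense linear order without endpoints; ''definable'' means with parameters; order and product topologies. Locally l-visceral: for every definable $X\subseteq M$ and $a\in M$ there is an open interval $I\ni a$ with $X\cap I$ a union of a finite set and an open set. Property (d): if $X\subseteq M^n$ is definable and $\pi:M^n\to M^d$ is a coordinate projection such that $X\cap\pi^{-1}(x)$ is discrete for all $x\in\pi(X)$, then there is a definable map $\tau:\pi(X)\to X$ with $\pi(\tau(x))=x$ for all $x$. Property (B): if $X\subseteq M^{n+1}$ is definable, $\pi:M^{n+1}\to M^n$ forgets the last coordinate, $\pi(X)$ has nonempty interior and $X_x=\{y:(x,y)\in X\}$ has nonempty interior for each $x\in\pi(X)$, then $X$ has nonempty interior. $\overline M$ is $M$ together with all definable gaps $(A,B)$ (nonempty definable $A,B$, $M=A\cup B$, $A<B$, $A$ without maximum, $B$ without minimum), naturally ordered; a definable function $F:X\to\overline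 M$ is one given by $F(x)=\sup Y_x$ for a definable $Y$ projecting onto $X$. $*$-continuity property: for every definable $f:B\to\overline M$ on a nonempty open box $B$ there is a nonempty open box $U\subseteq B$ with $f|_U$ continuous. Dimension: for nonempty definable $X\subseteq M^n$, $\dim X$ is the largest $d$ such that $\pi(X)$ has nonempty interior for some coordinate projection $\pi:M^n\to M^d$; $\dim\emptyset=-\infty$. *)

(* Defs.v *)
From HB Require Import structures.
From mathcomp Require Import all_boot all_order all_algebra.
From mathcomp Require Import all_classical all_reals all_analysis.

Set Implicit Arguments.
Unset Strict Implicit.
Unset Printing Implicit Defensive.

Import Order.TTheory.
Local Open Scope classical_set_scope.

Definition dense_no_endpoints d (M : orderType d) : Prop :=
  [/\ [set: M] !=set0,
      forall a b : M, (a < b)%O -> exists2 c, (a < c)%O & (c < b)%O,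
      forall a : M, exists b, (b < a)%O
    & forall a : M, exists b, (a < b)%O].

Record language := Language {
  fun_sym : Type;
  fun_arity : fun_sym -> nat;
  rel_sym : Type;
  rel_arity : rel_sym -> nat }.

Record fo_structure (L : language) (M : Type) := FoStructure {
  fun_interp : forall f : fun_sym L, ('I_(fun_arity f) -> M) -> M;
  rel_interp : forall r : rel_sym L, ('I_(rel_arity r) -> M) -> Prop }.

(* Terms and formulas of the language obtained from L by adding the symbol <
   and a constant for every element of M. The free variables range over V; the
   variable bound by a quantifier is the extra point None of option V. *)
Inductive term (L : language) (M V : Type) : Type :=
| Tvar of V
| Tpar of M
| Tapp (f : fun_sym L) of ('I_(fun_arity f) -> term L M V).

Inductive formula (L : language) (M : Type) : Type -> Type :=
| Feq V of term L M V & term L M V : formula L M V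
| Flt V of term L M V & term L M V : formula L M V
| Frel V (r : rel_sym L) of ('I_(rel_arity r) -> term L M V) : formula L M V
| Fnot V of formula L M V : formula L M V
| Fand V of formula L M V & formula L M V : formula L M V
| Fex V of formula L M (option V) : formula L M V.

Section definability.
Context d (M : orderTopologicalType d) (L : language) (S : fo_structure L M).

Fixpoint teval V (v : V -> M) (t : term L M V) : M :=
  match t with
  | Tvar x => v x
  | Tpar a => a
  | Tapp f ts => @fun_interp _ _ S f (fun i => teval v (ts i))
  end.

Fixpoint sat V (phi : formula L M V) : (V -> M) -> Prop :=
  match phi with
  | Feq _ t u => fun v => teval v t = teval v u
  | Flt _ t u => fun v => (teval v t < teval v u)%O
  | Frel _ r ts => fun v => @rel_interp _ _ S r (fun i => teval v (ts i))
  | Fnot _ phi => fun v => ~ sat phi v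
  | Fand _ phi psi => fun v => sat phi v /\ sat psi v
  | Fex _ phi => fun v => exists a : M, sat phi (fun x => odflt a (omap v x))
  end.

Definition definable n (X : set 'rV[M]_n) : Prop :=
  exists phi : formula L M 'I_n, X = [set x | sat phi (x ord0)].

Definition definable1 (X : set M) : Prop :=
  definable [set x : 'rV[M]_1 | X (x ord0 ord0)].

(* A map X -> M^m is represented by a total map, of which only the restriction
   to X matters. *)
Definition definable_map n m (X : set 'rV[M]_n) (f : 'rV[M]_n -> 'rV[M]_m) :
  Prop := definable [set row_mx x (f x) | x in X].

Definition open_box n (B : set 'rV[M]_n) : Prop :=
  exists2 I : 'I_n -> interval M, (forall i, itv_open_ends (I i))
    & B = [set x | forall i, x ord0 i \in I i].

(* The map colsub s : M^n -> M^e is the coordinate projection keeping the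
   coordinates s 0 < ... < s (e - 1). *)
Definition coord_choice e n (s : 'I_e -> 'I_n) : Prop :=
  {homo s : i j / (i < j)%N}.

Definition proj_interior n (X : set 'rV[M]_n) (e : nat) : Prop :=
  exists2 s : 'I_e -> 'I_n, coord_choice s
    & (colsub s @` X : set 'rV[M]_e)° !=set0.

(* M^0 is a point, so e = 0 always qualifies when X is nonempty. *)
Definition topdim n (X : set 'rV[M]_n) : \bar int :=
  if `[< X !=set0 >]
  then ((\max_(e < n.+1 | `[< proj_interior X e >]) e)%N%:Z)%:E
  else -oo%E.

Definition fiber n (X : set 'rV[M]_(n + 1)) (x : 'rV[M]_n) : set M :=
  [set y | X (row_mx x (const_mx y))].

Definition locally_l_visceral : Prop :=
  forall (X : set M) (a : M), definable1 X ->
  exists I : interval M, [/\ itv_open_ends I, a \in I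
    & exists F U : set M,
        [/\ finite_set F, open U & X `&` [set` I] = F `|` U]].

Definition discrete_subset (T : topologicalType) (A : set T) : Prop :=
  A `<=` isolated A.

Definition property_d : Prop :=
  forall n e (X : set 'rV[M]_n) (s : 'I_e -> 'I_n),
  definable X -> coord_choice s ->
  (forall x, (colsub s @` X) x ->
     discrete_subset (X `&` [set z | colsub s z = x])) ->
  exists tau : 'rV[M]_e -> 'rV[M]_n,
    definable_map (colsub s @` X) tau /\
    (forall x, (colsub s @` X) x -> X (tau x) /\ colsub s (tau x) = x).

Definition property_B : Prop :=
  forall n (X : set 'rV[M]_(n + 1)), definable X ->
  (lsubmx @` X : set 'rV[M]_n)° !=set0 ->
  (forall x, (lsubmx @` X) x -> (fiber X x)° !=set0) ->
  X° !=set0.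

Record gap := Gap {
  gapl : set M;
  gapr : set M;
  gapl_def : definable1 gapl;
  gapr_def : definable1 gapr;
  gapl_neq0 : gapl !=set0;
  gapr_neq0 : gapr !=set0;
  gapU : gapl `|` gapr = setT;
  gap_lt : forall a b, gapl a -> gapr b -> (a < b)%O;
  gapl_nomax : ~ (exists2 a, gapl a & ubound gapl a);
  gapr_nomin : ~ (exists2 b, gapr b & lbound gapr b) }.

Inductive Mbar : Type := Mpt of M | Mgap of gap.

Definition Mbar_le (x y : Mbar) : bool :=
  match x, y with
  | Mpt a, Mpt b => (a <= b)%O
  | Mpt a, Mgap g => `[< gapl g a >]
  | Mgap g, Mpt b => `[< gapr g b >]
  | Mgap g, Mgap h => `[< gapl g `<=` gapl h >]
  end.

Lemma gaplr (g : gap) a : gapl g a \/ gapr g a.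
Proof. by have := @gapU g => /seteqP[_ /(_ a)]; apply. Qed.

Lemma gapl_gaprN (g : gap) a : gapl g a -> ~ gapr g a.
Proof. by move=> la /(gap_lt la); rewrite ltxx. Qed.

Lemma gapl_le (g : gap) a b : gapl g b -> (a <= b)%O -> gapl g a.
Proof.
move=> lb ab; case: (gaplr g a) => // /(gap_lt lb).
by rewrite ltNge ab.
Qed.

Lemma gapr_le (g : gap) a b : gapr g a -> (a <= b)%O -> gapr g b.
Proof.
move=> ra ab; case: (gaplr g b) => // /(@gap_lt g b a)/(_ ra).
by rewrite ltNge ab.
Qed.

Lemma gap_eq (g h : gap) : gapl g = gapl h -> g = h.
Proof.
move=> e; have er : gapr g = gapr h.
  rewrite eqEsubset; split=> a ra.
    by case: (gaplr h a) => //; rewrite -e => /gapl_gaprN.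
  by case: (gaplr g a) => //; rewrite e => /gapl_gaprN.
case: g h e er => [A B ? ? ? ? ? ? ? ?] [A' B' ? ? ? ? ? ? ? ?] /= e e'.
by subst A' B'; congr Gap; exact: Prop_irrelevance.
Qed.

Lemma Mbar_le_refl : reflexive Mbar_le.
Proof. by case=> [a|g] /=; [exact: lexx|exact/asboolP]. Qed.

Lemma Mbar_le_anti : antisymmetric Mbar_le.
Proof.
case=> [a|g] [b|h] /= /andP[].
- by move=> ab ba; congr Mpt; apply: le_anti; rewrite ab ba.
- by move=> /asboolP la /asboolP/(gapl_gaprN la).
- by move=> /asboolP rb /asboolP/gapl_gaprN/(_ rb).
- move=> /asboolP gh /asboolP hg; congr Mgap; apply: gap_eq.
  by rewrite eqEsubset.
Qed.

Lemma Mbar_le_trans : transitive Mbar_le.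
Proof.
case=> [b|h] [a|g] [c|k] /=.
- exact: le_trans.
- by move=> ab /asboolP lb; apply/asboolP; exact: gapl_le lb ab.
- by move=> /asboolP rb bc; apply/asboolP; exact: gapr_le rb bc.
- move=> /asboolP rb /asboolP lb; apply/asboolP => a la.
  by apply: gapl_le lb _; exact/ltW/(gap_lt la rb).
- by move=> /asboolP la /asboolP rc; exact/ltW/(gap_lt la rc).
- by move=> /asboolP la /asboolP hk; apply/asboolP/hk.
- move=> /asboolP gh /asboolP rc; apply/asboolP.
  by case: (gaplr g c) => // /gh/gapl_gaprN.
- by move=> /asboolP gh /asboolP hk; apply/asboolP => a /gh/hk.
Qed.

Lemma Mbar_le_total : total Mbar_le.
Proof.
case=> [a|g] [b|h] /=; first exact: le_total.
- by case: (gaplr h a) => p; apply/orP; [left|right]; exact/asboolP.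
- by case: (gaplr g b) => p; apply/orP; [right|left]; exact/asboolP.
- apply/orP; have [|gh] := pselect (gapl g `<=` gapl h).
    by left; exact/asboolP.
  right; apply/asboolP => b lb.
  have [a ga ha] : exists2 a, gapl g a & ~ gapl h a.
    apply: contrapT => no; apply: gh => a ga; apply: contrapT => ha.
    by apply: no; exists a.
  apply: gapl_le ga _; apply/ltW; apply: gap_lt lb _.
  by case: (gaplr h a).
Qed.

HB.instance Definition _ := gen_eqMixin Mbar.
HB.instance Definition _ := gen_choiceMixin Mbar.
HB.instance Definition _ := @Order.Le_isPOrder.Build d Mbar
  Mbar_le Mbar_le_refl Mbar_le_anti Mbar_le_trans.
HB.instance Definition _ := Order.POrder_isTotal.Build d Mbar Mbar_le_total.

Definition definable_Mbar_fun n (X : set 'rV[M]_n) (F : 'rV[M]_n -> Mbar) :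
  Prop :=
  exists Y : set 'rV[M]_(n + 1),
    [/\ definable Y, lsubmx @` Y = X
      & forall x, X x -> supremums (Mpt @` fiber Y x) (F x)].

Definition star_continuity : Prop :=
  forall n (B : set 'rV[M]_n) (F : 'rV[M]_n -> Mbar),
  open_box B -> B !=set0 -> definable_Mbar_fun B F ->
  exists U : set 'rV[M]_n,
    [/\ open_box U, U !=set0, U `<=` B
      & {within U, continuous (F : 'rV[M]_n -> order_topology Mbar)}].

Definition discontinuities n m (X : set 'rV[M]_n) (f : 'rV[M]_n -> 'rV[M]_m) :
  set 'rV[M]_n := [set x | X x /\ ~ (f @ within X (nbhs x) --> f x)].

Definition homeo_onto_image n m (B : set 'rV[M]_n) (f : 'rV[M]_n -> 'rV[M]_m) :
  Prop :=
  {within B, continuous f} /\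
  exists g : 'rV[M]_m -> 'rV[M]_n,
    {in B, cancel f g} /\ {within f @` B, continuous g}.

Definition embeds_box n (X : set 'rV[M]_n) (e : nat) : Prop :=
  exists (B : set 'rV[M]_e) (f : 'rV[M]_e -> 'rV[M]_n),
    [/\ open_box B, B !=set0, definable_map B f, f @` B `<=` X
      & set_inj B f /\ homeo_onto_image B f].

End definability.

Definition is_max_nat (P : nat -> Prop) (m : nat) : Prop :=
  P m /\ forall e, P e -> (e <= m)%N.

(* Main.v *)
Require Import Defs.
From HB Require Import structures.
From mathcomp Require Import all_boot all_order all_algebra.
From mathcomp Require Import all_classical all_reals all_analysis.

(* Property (B), iterated, says that a definable family over an open set whose
   fibers all have interior contains a product of two boxes. It is used mostly
   on families of boxes: if for every v in an open set some box around tau v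
   isolates tau v in a fiber, then the pairs of corners of such boxes form a set
   with interior, so a single pair of corners works for all v in a smaller open
   set. Let dim X = d and let the projection of a definable subset Q of X along
   d coordinates have interior. Over a generic point the fiber of X is closed and
   discrete, so (d) and the continuity property give a continuous section tau of
   Q over a box, and the previous remark gives an open V with V `&` X = tau(box).
   Taking for Q the discontinuity set gives (1), since f is near tau(v) the
   continuous map f o tau o pi; Q = X gives (4) and one half of (3). For (2) the
   same uniformization of corners yields an open set that misses X but meets its
   closure. For the other half of (3), a section of the image reduces the claim
   to the fact that a definable map from a box of M^e to M^d with d < e is not
   injective, which follows by induction on d from: a definable map from a box of
   M^(n+1) to M has a fiber containing an injective image of a box of M^n. *)

Set Implicit Arguments.
Unset Strict Implicit.
Unset Printing Implicit Defensive.

Import Order.TTheory.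
Local Open Scope classical_set_scope.

(** * Tuples indexed by arbitrary types *)

Section tuples.
Context {M : Type}.

Definition optf (V : Type) (v : V -> M) (y : M) : option V -> M :=
  fun x => if x is Some i then v i else y.

Definition sumf (V W : Type) (v : V -> M) (w : W -> M) : V + W -> M :=
  fun x => match x with inl i => v i | inr j => w j end.

Lemma optfK (V : Type) (u : option V -> M) :
  optf (fun i => u (Some i)) (u None) = u.
Proof. by apply/funext; case. Qed.

Lemma fun_card0 (V : finType) (v w : V -> M) : #|V| = 0 -> v = w.
Proof.
move=> V0; apply/funext => i; have := fintype0 i V0; by [].
Qed.

End tuples.

Lemma bij_card (T1 T2 : finType) (h : #|T1| = #|T2|) :
  exists f : T1 -> T2, bijective f.
Proof.
exists (fun x => enum_val (cast_ord h (enum_rank x))).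
exists (fun y => enum_val (cast_ord (esym h) (enum_rank y))) => x.
  by rewrite enum_valK cast_ordK enum_rankK.
by rewrite enum_valK cast_ordKV enum_rankK.
Qed.

(** This replaces induction on the exponent of M^n: coordinates are indexed by finite types, and a
    new coordinate is the point [None]. It holds because a finite type is determined up to bijection
    by its cardinality. *)
Lemma finType_option_ind (P : finType -> Prop) :
    (forall (V W : finType) (f : V -> W), bijective f -> P V -> P W) ->
    P void -> (forall V : finType, P V -> P (option V)) ->
  forall V, P V.
Proof.
move=> Pbij P0 PS V; have [n] := ubnP #|V|; elim: n V => // n IH V.
rewrite ltnS leq_eqVlt => /predU1P[Vn|/IH//].
case: n IH Vn => [_ V0|n IH Vn].
  by have [f bf] := @bij_card void V (etrans card_void (esym V0));
    exact: Pbij bf P0.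
have h : #|{: option 'I_n}| = #|V| by rewrite card_option card_ord Vn.
have [f bf] := bij_card h; apply: Pbij bf (PS _ (IH _ _)).
by rewrite card_ord.
Qed.

(** * Definable predicates and partial definable functions *)

Section definable_predicates.
Context {disp : Order.disp_t} {M : orderTopologicalType disp} {L : language}.
Context (S : fo_structure L M).

(** The index type V is arbitrary, so that adding a coordinate is [option V], a product of powers is
    [V + W], and no arithmetic on ordinals is involved. *)
Definition dpred (V : Type) (P : (V -> M) -> Prop) : Prop :=
  exists phi : formula L M V, forall v, sat S phi v <-> P v.

Fixpoint tsubst (V W : Type) (r : V -> term L M W) (t : term L M V) :
    term L M W :=
  match t with
  | Tvar x => r x
  | Tpar a => Tpar L W a
  | Tapp f ts => @Tapp L M W f (fun i => tsubst r (ts i))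
  end.

Lemma teval_tsubst (V W : Type) (r : V -> term L M W) (t : term L M V)
    (v : W -> M) :
  teval S v (tsubst r t) = teval S (fun x => teval S v (r x)) t.
Proof.
elim: t => //= f ts IH; congr (fun_interp _ _); apply/funext => i; exact: IH.
Qed.

Definition subst_lift (V W : Type) (r : V -> term L M W) (x : option V) :
    term L M (option W) :=
  if x is Some y then tsubst (fun z => Tvar L M (Some z)) (r y)
  else Tvar L M None.

Fixpoint fsubst (V : Type) (phi : formula L M V) :
    forall W : Type, (V -> term L M W) -> formula L M W :=
  match phi with
  | Feq _ t u => fun W r => Feq (tsubst r t) (tsubst r u)
  | Flt _ t u => fun W r => Flt (tsubst r t) (tsubst r u)
  | Frel _ s ts => fun W r => @Frel L M W s (fun i => tsubst r (ts i))
  | Fnot _ phi => fun W r => Fnot (fsubst phi r)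
  | Fand _ phi psi => fun W r => Fand (fsubst phi r) (fsubst psi r)
  | Fex _ phi => fun W r => Fex (fsubst phi (subst_lift r))
  end.

Lemma sat_fsubst (V : Type) (phi : formula L M V) (W : Type)
    (r : V -> term L M W) (v : W -> M) :
  sat S (fsubst phi r) v <-> sat S phi (fun x => teval S v (r x)).
Proof.
elim: phi W r v => {V} /= [V t u|V t u|V s ts|V phi IH|V phi IH psi IH'|V phi IH]
  W r v.
- by rewrite !teval_tsubst.
- by rewrite !teval_tsubst.
- suff -> : (fun i => teval S v (tsubst r (ts i))) =
    (fun i => teval S (fun x => teval S v (r x)) (ts i)) by [].
  by apply/funext => i; rewrite teval_tsubst.
- by rewrite IH.
- by rewrite IH IH'.
- suff E a : (fun x => teval S (fun y => odflt a (omap v y)) (subst_lift r x)) =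
      (fun x => odflt a (omap (fun x => teval S v (r x)) x)).
    by split=> -[a ha]; exists a; move: ha; rewrite IH E.
  by apply/funext => -[x|] //=; rewrite teval_tsubst.
Qed.

Lemma dpred_ext (V : Type) (P Q : (V -> M) -> Prop) :
  (forall v, P v <-> Q v) -> dpred P -> dpred Q.
Proof. by move=> PQ [phi h]; exists phi => v; rewrite h. Qed.

Lemma dpred_not (V : Type) (P : (V -> M) -> Prop) :
  dpred P -> dpred (fun v => ~ P v).
Proof. by move=> [phi h]; exists (Fnot phi) => v /=; rewrite h. Qed.

Lemma dpred_and (V : Type) (P Q : (V -> M) -> Prop) :
  dpred P -> dpred Q -> dpred (fun v => P v /\ Q v).
Proof.
by move=> [phi h] [psi h']; exists (Fand phi psi) => v /=; rewrite h h'.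
Qed.

Lemma dpred_imp (V : Type) (P Q : (V -> M) -> Prop) :
  dpred P -> dpred Q -> dpred (fun v => P v -> Q v).
Proof.
move=> hP hQ; apply: (dpred_ext _ (dpred_not (dpred_and hP (dpred_not hQ)))).
by move=> v; split=> [h p|h [/h]//]; apply: contrapT => q; exact: h.
Qed.

Lemma dpred_ex (V : Type) (P : (V -> M) -> M -> Prop) :
  dpred (fun u : option V -> M => P (fun i => u (Some i)) (u None)) ->
  dpred (fun v => exists y, P v y).
Proof.
move=> [phi h]; exists (Fex phi) => v /=.
by split=> -[y hy]; exists y; move: hy; rewrite h.
Qed.

Lemma dpred_all (V : Type) (P : (V -> M) -> M -> Prop) :
  dpred (fun u : option V -> M => P (fun i => u (Some i)) (u None)) ->
  dpred (fun v => forall y, P v y).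
Proof.
move=> /dpred_not/(@dpred_ex V (fun v y => ~ P v y))/dpred_not.
apply: dpred_ext => v; split=> [h y|h [y]]; last exact.
by apply: contrapT => n; apply: h; exists y.
Qed.

(** Atomic formulas and changes of variables use only these terms; definable functions are
    substituted through their graphs instead, by [dpred_comp]. *)
Definition coordf (V : Type) (t : (V -> M) -> M) : Prop :=
  (exists i, t = fun v => v i) \/ (exists c, t = fun=> c).

Lemma coordf_term (V : Type) (t : (V -> M) -> M) : coordf t ->
  exists s : term L M V, forall v, teval S v s = t v.
Proof.
by case=> [[i ->]|[c ->]]; [exists (Tvar L M i)|exists (Tpar L V c)].
Qed.

Lemma dpred_eq (V : Type) (t u : (V -> M) -> M) :
  coordf t -> coordf u -> dpred (fun v => t v = u v).
Proof.
move=> /coordf_term[s hs] /coordf_term[s' hs']; exists (Feq s s') => v /=.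
by rewrite hs hs'.
Qed.

Lemma dpred_lt (V : Type) (t u : (V -> M) -> M) :
  coordf t -> coordf u -> dpred (fun v => (t v < u v)%O).
Proof.
move=> /coordf_term[s hs] /coordf_term[s' hs']; exists (Flt s s') => v /=.
by rewrite hs hs'.
Qed.

Lemma dpred_app (V W : Type) (R : (W -> M) -> Prop)
    (t : (V -> M) -> W -> M) :
  dpred R -> (forall w, coordf (t^~ w)) -> dpred (fun v => R (t v)).
Proof.
move=> [phi h] /(_ _)/coordf_term/cid-/all_sig[s hs].
exists (fsubst phi s) => v; rewrite sat_fsubst h.
by rewrite (_ : (fun x => _) = t v) //; apply/funext => w; exact: hs.
Qed.

Context (M_neq0 : [set: M] !=set0).

Lemma dpred_true (V : Type) : dpred (fun _ : V -> M => True).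
Proof.
have [c _] := M_neq0.
apply: (@dpred_ext _ (fun _ => c = c)); first by [].
by apply: dpred_eq; right; exists c.
Qed.

Lemma dpred_const (V : Type) (P : Prop) : dpred (fun _ : V -> M => P).
Proof.
have [p|p] := pselect P.
  by apply: dpred_ext (dpred_true V).
by apply: dpred_ext (dpred_not (dpred_true V)) => v; split.
Qed.

Lemma dpred_allfin (V : Type) (I : finType) (P : I -> (V -> M) -> Prop) :
  (forall i, dpred (P i)) -> dpred (fun v => forall i, P i v).
Proof.
move=> hP; suff H (s : seq I) : dpred (fun v => forall i, i \in s -> P i v).
  apply: dpred_ext (H (enum I)) => v.
  by split=> h i *; apply: h; rewrite ?mem_enum.
elim: s => [|j s IH]; first by apply: dpred_ext (dpred_true V).
apply: dpred_ext (dpred_and (hP j) IH) => v; split=> [[h1 h2] i|h].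
  by rewrite inE => /predU1P[->//|]; exact: h2.
by split=> [|i si]; apply: h; rewrite inE ?eqxx// si orbT.
Qed.

Lemma dpred_exfin (V : Type) (I : finType) (P : I -> (V -> M) -> Prop) :
  (forall i, dpred (P i)) -> dpred (fun v => exists i, P i v).
Proof.
move=> hP; apply: (dpred_ext _ (dpred_not (@dpred_allfin _ _
   (fun i v => ~ P i v) (fun i => dpred_not (hP i))))) => v.
split=> [h|[i p] /(_ i)/(_ p)//].
by apply: contrapT => n; apply: h => i p; apply: n; exists i.
Qed.

Lemma dpred_exs (W : finType) (V : Type) (P : (V -> M) -> (W -> M) -> Prop) :
  dpred (fun u : V + W -> M => P (fun i => u (inl i)) (fun j => u (inr j))) ->
  dpred (fun v => exists w, P v w).
Proof.
elim/finType_option_ind: W V P => [W W' f [g fK gK] IH V P hP|V P hP|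
    W IH V P hP].
- apply: (@dpred_ext _ (fun v => exists w : W -> M, P v (fun j => w (g j)))).
    move=> v; split=> [[w h]|[w h]]; first by eexists; exact: h.
    exists (fun j => w (f j)); rewrite (_ : (fun j => _) = w)//.
    by apply/funext => j; rewrite gK.
  apply: IH; apply: (@dpred_app _ _ _ (fun u x => match x with
    inl i => u (inl i) | inr j => u (inr (g j)) end) hP).
  by case=> [i|i]; left; eexists.
- have [c _] := M_neq0.
  apply: (@dpred_ext _ (fun v => P v (fun _ => c))).
    move=> v; split=> [|[w]]; first by eexists; eassumption.
    by rewrite (@fun_card0 _ _ w (fun=> c)) ?card_void.
  apply: (@dpred_app _ _ _ (fun u => sumf u (fun=> c)) hP).
  by case=> [i|[]]; left; eexists.
- apply: (@dpred_ext _ (fun v => exists y w, P v (optf w y))).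
    move=> v; split=> [[y [w h]]|[w h]]; first by eexists; exact: h.
    by exists (w None), (fun j => w (Some j)); rewrite optfK.
  apply/dpred_ex/(IH (option V) (fun u w =>
    P (fun i => u (Some i)) (optf w (u None)))).
  apply: (@dpred_app _ _ _ (fun u x => match x with
    inl i => u (inl (Some i)) | inr (Some j) => u (inr j)
    | inr None => u (inl None) end) hP).
  by case=> [i|[j|]]; left; eexists.
Qed.

Lemma dpred_alls (W : finType) (V : Type) (P : (V -> M) -> (W -> M) -> Prop) :
  dpred (fun u : V + W -> M => P (fun i => u (inl i)) (fun j => u (inr j))) ->
  dpred (fun v => forall w, P v w).
Proof.
move=> /dpred_not/(@dpred_exs W V (fun v w => ~ P v w))/dpred_not.
apply: dpred_ext => v; split=> [h w|h [w]]; last exact.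
by apply: contrapT => n; apply: h; exists w.
Qed.

(* The graph of f over P is definable; f is arbitrary outside P. *)
Definition dfun (V : Type) (P : (V -> M) -> Prop) (f : (V -> M) -> M) : Prop :=
  dpred (fun u : option V -> M =>
    P (fun i => u (Some i)) /\ f (fun i => u (Some i)) = u None).

(** [R (t v)] says that some w in R agrees with [t v] in every coordinate. The conjunct [P v] is
    repeated because the graph of t is controlled only over P. *)
Lemma dpred_comp (V : Type) (W : finType) (P : (V -> M) -> Prop)
    (R : (W -> M) -> Prop) (t : (V -> M) -> W -> M) :
  dpred P -> (forall w, dfun P (t^~ w)) -> dpred R ->
  dpred (fun v => P v /\ R (t v)).
Proof.
move=> hP ht hR.
apply: (@dpred_ext _ (fun v => exists w, (P v /\ R w) /\
    forall j, P v /\ t v j = w j)).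
  move=> v; split=> [[w [[p r] /all_and2[_ h]]]|[p r]]; last by exists (t v).
  by split=> //; rewrite (_ : t v = w)//; exact/funext.
apply: dpred_exs; apply: dpred_and.
  apply: dpred_and.
    by apply: (dpred_app hP) => i; left; exists (inl i).
  by apply: (dpred_app hR) => i; left; exists (inr i).
apply: dpred_allfin => j.
apply: (@dpred_app _ _ _ (fun u x => if x is Some i then u (inl i) else u (inr j))
  (ht j)).
by case=> [i|]; left; eexists.
Qed.

Lemma dfun_comp (V : Type) (W : finType) (P : (V -> M) -> Prop)
    (R : (W -> M) -> Prop) (t : (V -> M) -> W -> M) g :
  dpred P -> (forall w, dfun P (t^~ w)) -> (forall v, P v -> R (t v)) ->
  dfun R g -> dfun P (fun v => g (t v)).
Proof.
move=> hP ht PR hg; rewrite /dfun.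
pose Q := fun u : option V -> M => P (fun i => u (Some i)).
have hQ : dpred Q by apply: (dpred_app hP) => i; left; eexists.
(* The graph of the composite is the preimage of the graph of g under (v, y) |-> (t v, y). *)
apply: (dpred_ext _ (@dpred_comp _ _ Q _ (fun u => optf (t (fun i => u (Some i)))
  (u None)) hQ _ hg)).
  move=> u; split=> [[p []]|[p e]]; first by [].
  by split=> //; split=> //; exact: PR.
case=> [j|].
  apply: (@dpred_app _ _ _ (fun u x => if x is Some i then u (Some (Some i))
    else u None) (ht j)).
  by case=> [i|]; left; eexists.
apply: dpred_and; first by apply: (dpred_app hQ) => i; left; eexists.
by apply: dpred_eq; left; eexists.
Qed.

Lemma dfun_coord (V : Type) (P : (V -> M) -> Prop) t :
  dpred P -> coordf t -> dfun P t.
Proof.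
move=> hP ht; apply: dpred_and.
  by apply: (dpred_app hP) => i; left; eexists.
apply: dpred_eq; last by left; eexists.
by case: ht => [[i ->]|[c ->]]; [left|right]; eexists.
Qed.

Lemma dfun_sub (V : Type) (P Q : (V -> M) -> Prop) f :
  dpred Q -> (forall v, Q v -> P v) -> dfun P f -> dfun Q f.
Proof.
move=> hQ QP hf; apply: (dpred_ext _ (dpred_and hf (dpred_app
  (t := fun (u : option V -> M) i => u (Some i)) hQ _))) => [u|i].
  by split=> [[[]]|[q e]] //; do 2!split=> //; exact: QP.
by left; eexists.
Qed.

End definable_predicates.

Ltac coordf_tac := intros; repeat match goal with
  | |- coordf _ => first [left; eexists; reflexivity | right; eexists; reflexivity
      | progress cbv beta iota delta [optf sumf]]
  | x : (_ + _)%type |- _ => destruct x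
  | x : option _ |- _ => destruct x
  | x : void |- _ => destruct x
  | x : unit |- _ => destruct x
  end.

(** * Boxes and sets with nonempty interior *)

Section boxes.
Context {disp : Order.disp_t} {M : orderTopologicalType disp}.

(** All corners lie in M. Such boxes form a base of the product topology because M has no endpoints
    ([nbhs_box]). *)
Definition box (V : Type) (a b v : V -> M) : Prop :=
  forall i, (a i < v i < b i)%O.

(** Nonempty interior ([interior_fat]), stated by quantifying over corners so that it is a
    first-order condition on the parameters of P. *)
Definition fat (V : Type) (P : (V -> M) -> Prop) : Prop :=
  exists a b v, box a b v /\ forall w, box a b w -> P w.

Definition fat1 (Q : M -> Prop) : Prop :=
  exists a b y, (a < y < b)%O /\ forall z, (a < z < b)%O -> Q z.

Lemma fat_sub (V : Type) (P Q : (V -> M) -> Prop) :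
  (forall v, P v -> Q v) -> fat P -> fat Q.
Proof.
by move=> PQ [a [b [v [abv h]]]]; exists a, b, v; split=> // w /h/PQ.
Qed.

Lemma fat1_sub (P Q : M -> Prop) : (forall y, P y -> Q y) -> fat1 P -> fat1 Q.
Proof.
by move=> PQ [a [b [v [abv h]]]]; exists a, b, v; split=> // w /h/PQ.
Qed.

Lemma fat_ren (V W : Type) (f : V -> W) (g : W -> V) (P : (V -> M) -> Prop) :
  cancel f g -> fat P -> fat (fun w => P (fun i => w (f i))).
Proof.
move=> fK [a [b [v [abv h]]]].
exists (fun j => a (g j)), (fun j => b (g j)), (fun j => v (g j)).
by split=> [j|w abw]; [exact: abv|apply: h => i; have := abw (f i); rewrite fK].
Qed.

(** Coordinate projections are open: coordinates outside the image of f are filled in from the fixed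
    point w of the box. *)
Lemma fat_inj (V W : finType) (f : V -> W) (P : (W -> M) -> Prop) :
  injective f -> fat P -> fat (fun v => exists2 w, P w & forall i, w (f i) = v i).
Proof.
move=> finj [a [b [w [abw h]]]].
exists (fun i => a (f i)), (fun i => b (f i)), (fun i => w (f i)).
split=> [i|v abv]; first exact: abw.
exists (fun j => if [pick i | f i == j] is Some i then v i else w j).
  by apply: h => j; case: pickP => [i /eqP<-|_]; [exact: abv|exact: abw].
by move=> i; case: pickP => [j /eqP/finj->//|/(_ i)]; rewrite eqxx.
Qed.

Lemma box_opt (V : Type) (a b v : V -> M) (c d y : M) :
  box a b v -> (c < y < d)%O -> box (optf a c) (optf b d) (optf v y).
Proof. by move=> abv cdw [i|//]; exact: abv. Qed.

Lemma fat_sum (V W : Type) (P : (V -> M) -> (W -> M) -> Prop) :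
  fat (fun u : V + W -> M => P (fun i => u (inl i)) (fun j => u (inr j))) ->
  exists a b v c d w, [/\ box a b v, box c d w
    & forall v' w', box a b v' -> box c d w' -> P v' w'].
Proof.
move=> [a [b [u [abu h]]]].
exists (fun i => a (inl i)), (fun i => b (inl i)), (fun i => u (inl i)).
exists (fun i => a (inr i)), (fun i => b (inr i)), (fun i => u (inr i)).
split=> [i|i|v w abv abw]; [exact: abu|exact: abu|].
by apply: (h (sumf v w)) => -[]; [exact: abv|exact: abw].
Qed.

Lemma fat_opt (V : Type) (P : (V -> M) -> M -> Prop) :
  fat (fun u : option V -> M => P (fun i => u (Some i)) (u None)) ->
  exists a b v c d y, [/\ box a b v, (c < y < d)%O
    & forall v' y', box a b v' -> (c < y' < d)%O -> P v' y'].
Proof.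
move=> [a [b [u [abu h]]]].
exists (fun i => a (Some i)), (fun i => b (Some i)), (fun i => u (Some i)).
exists (a None), (b None), (u None).
split=> [i||v w abv abw]; [exact: abu|exact: abu|].
by apply: (h (optf v w)) => -[i|//]; exact: abv.
Qed.

Lemma box_meet (V : Type) (a b c d v : V -> M) : box a b v -> box c d v ->
  exists e f, box e f v /\ forall w, box e f w -> box a b w /\ box c d w.
Proof.
move=> abv cdv; exists (fun i => Order.max (a i) (c i)),
  (fun i => Order.min (b i) (d i)).
split=> [i|w h].
  rewrite gt_max lt_min.
  by have /andP[-> ->] := abv i; have /andP[-> ->] := cdv i.
split=> i; have := h i; rewrite gt_max lt_min => /andP[/andP[? ?] /andP[? ?]];
by apply/andP.
Qed.

Lemma oo_itvI (a b c d x : M) : (a < x < b)%O -> (c < x < d)%O ->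
  exists e f, (e < x < f)%O /\ forall y, (e < y < f)%O ->
    (a < y < b)%O /\ (c < y < d)%O.
Proof.
move=> /andP[ax xb] /andP[cx xd]; exists (Order.max a c), (Order.min b d).
rewrite gt_max lt_min ax xb cx xd; split=> // y.
by rewrite gt_max lt_min => /andP[/andP[-> ->] /andP[-> ->]].
Qed.

Context (M_dlo : dense_no_endpoints M).

Lemma M_neq0 : [set: M] !=set0. Proof. by case: M_dlo. Qed.

Lemma lt_mid (a b : M) : (a < b)%O -> exists c, (a < c < b)%O.
Proof. by case: M_dlo => _ h _ _ /h[c ac cb]; exists c; rewrite ac. Qed.

Lemma itv_ex (x : M) : exists a b, (a < x < b)%O.
Proof.
by case: M_dlo => _ _ /(_ x)[a ax] /(_ x)[b xb]; exists a, b; rewrite ax.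
Qed.

Lemma box_ex (V : Type) (v : V -> M) : exists a b, box a b v.
Proof.
have /choice[p h] : forall i, exists p : M * M, (p.1 < v i < p.2)%O.
  by move=> i; have [a [b ab]] := itv_ex (v i); exists (a, b).
by exists (fun i => (p i).1), (fun i => (p i).2).
Qed.

Lemma box_neq0 (V : Type) (a b : V -> M) :
  (forall i, (a i < b i)%O) -> exists v, box a b v.
Proof. by move=> ab; have [v h] := choice (fun i => lt_mid (ab i)); exists v. Qed.

Lemma nbhs_itv (x : M) (A : set M) : nbhs x A <->
  exists a b, (a < x < b)%O /\ forall y, (a < y < b)%O -> A y.
Proof.
rewrite itv_nbhsE; split=> [[I [oI xI] IA]|[a [b [axb h]]]]; last first.
  exists `]a, b[%O; first by split=> //; rewrite /itv_open_ends/= orbT.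
  by move=> y /=; rewrite in_itv/=; exact: h.
(* a0 and b0 cut off the sides on which I is unbounded. *)
have [a0 [b0 /andP[a0x xb0]]] := itv_ex x.
case: I oI xI IA => -[[] l|[]] [[] r|[]]// _; rewrite in_itv/= ?andbT => xI IA.
- by exists l, r; split=> // y lyr; apply: IA; rewrite /= in_itv.
- exists l, b0; split; first by rewrite xI.
  by move=> y /andP[ly _]; apply: IA; rewrite /= in_itv/= ly.
- exists a0, r; split; first by rewrite xI a0x.
  by move=> y /andP[_ ly]; apply: IA; rewrite /= in_itv/= ly.
- exists a0, b0; rewrite a0x xb0; split=> // y _; exact: IA.
Qed.

Lemma nbhs_box n (x : 'rV[M]_n) (A : set 'rV[M]_n) : nbhs x A <->
  exists a b, box a b (x ord0) /\ forall y : 'rV[M]_n, box a b (y ord0) -> A y.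
Proof.
split=> [[P xP PA]|[a [b [abx h]]]].
  have /choice[p h] : forall j, exists p : M * M, (p.1 < x ord0 j < p.2)%O /\
      forall y, (p.1 < y < p.2)%O -> P ord0 j y.
    by move=> j; have /nbhs_itv[a [b ab]] := xP ord0 j; exists (a, b).
  exists (fun i => (p i).1), (fun i => (p i).2);
    split=> [j|y aby]; first by have [] := h j.
  by apply: PA => i j; rewrite ord1; have [_] := h j; apply; exact: aby.
exists (fun _ j => [set y | (a j < y < b j)%O]).
  by move=> i j; rewrite ord1; apply/nbhs_itv; exists (a j), (b j); split.
by move=> y hy; apply: h => j; exact: hy.
Qed.

Definition pred_of n (X : set 'rV[M]_n) : ('I_n -> M) -> Prop :=
  fun v => X (\row_i v i)%R.

Lemma row_fun n (x : 'rV[M]_n) : (\row_i x ord0 i)%R = x.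
Proof. by apply/rowP => i; rewrite mxE. Qed.

Lemma fun_row n (v : 'I_n -> M) : (\row_i v i)%R ord0 = v.
Proof. by apply/funext => i; rewrite mxE. Qed.

Lemma interior_fat n (X : set 'rV[M]_n) : X° !=set0 <-> fat (pred_of X).
Proof.
split=> [[x /nbhs_box[a [b [abx h]]]]|[a [b [v [abv h]]]]].
  by exists a, b, (x ord0); split=> // w abw; apply: h; rewrite fun_row.
exists (\row_i v i)%R; apply/nbhs_box; exists a, b; rewrite fun_row; split=> //.
by move=> y /h; rewrite /pred_of row_fun.
Qed.

Lemma interior_fat1 (X : set M) : X° !=set0 <-> fat1 X.
Proof.
split=> [[x /nbhs_itv[a [b [abx h]]]]|[a [b [y [aby h]]]]].
  by exists a, b, x.
by exists y; apply/nbhs_itv; exists a, b.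
Qed.

Context {L : language} (S : fo_structure L M).

Lemma definable_pred n (X : set 'rV[M]_n) :
  definable S X <-> dpred S (pred_of X).
Proof.
split=> [[phi ->]|[phi h]]; exists phi.
  by move=> v; rewrite /pred_of/= fun_row.
by apply/seteqP; split=> x; rewrite /= h /pred_of row_fun.
Qed.

Lemma dpred_box (U : Type) (I : finType) (a b v : (U -> M) -> I -> M) :
  (forall i, coordf (a^~ i)) -> (forall i, coordf (b^~ i)) ->
  (forall i, coordf (v^~ i)) -> dpred S (fun u => box (a u) (b u) (v u)).
Proof.
move=> ha hb hv; rewrite /box; apply: (dpred_allfin M_neq0) => i.
apply: (@dpred_ext _ _ _ _ _ (fun u => (a u i < v u i)%O /\ (v u i < b u i)%O)).
  by move=> u; split=> /andP.
by apply: dpred_and; exact: dpred_lt.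
Qed.

Lemma dpred_itv (U : Type) (a b y : (U -> M) -> M) :
  coordf a -> coordf b -> coordf y -> dpred S (fun u => (a u < y u < b u)%O).
Proof.
move=> ha hb hy.
apply: (@dpred_ext _ _ _ _ _ (fun u => (a u < y u)%O /\ (y u < b u)%O)).
  by move=> u; split=> /andP.
by apply: dpred_and; exact: dpred_lt.
Qed.

End boxes.

(** * Thin sets on the line, and property (B) for products *)

Section visceral.
Context {disp : Order.disp_t} {M : orderTopologicalType disp}.
Context {L : language} {S : fo_structure L M}.
Context (M_dlo : dense_no_endpoints M).

Lemma dpred_fat (V : Type) (W : finType) (P : (V -> M) -> (W -> M) -> Prop) :
  dpred S (fun u : V + W -> M => P (fun i => u (inl i)) (fun j => u (inr j))) ->
  dpred S (fun v => fat (P v)).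
Proof.
move=> hP; rewrite /fat; have M0 := M_neq0 M_dlo.
apply: (dpred_exs M0); apply: (dpred_exs M0); apply: (dpred_exs M0).
apply: dpred_and; first by apply: dpred_box => //; coordf_tac.
apply: (dpred_alls M0); apply: dpred_imp.
  by apply: dpred_box => //; coordf_tac.
apply: (dpred_app (t := fun u x => match x with
  inl i => u (inl (inl (inl (inl i)))) | inr j => u (inr j) end) hP).
by coordf_tac.
Qed.

Lemma dpred_fat1 (V : Type) (P : (V -> M) -> M -> Prop) :
  dpred S (fun u : option V -> M => P (fun i => u (Some i)) (u None)) ->
  dpred S (fun v => fat1 (P v)).
Proof.
move=> hP; rewrite /fat1.
do 3!apply: dpred_ex.
apply: dpred_and; first by apply: dpred_itv; coordf_tac.
apply: dpred_all; apply: dpred_imp; first by apply: dpred_itv; coordf_tac.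
apply: (dpred_app (t := fun u x => match x with
  Some i => u (Some (Some (Some (Some i)))) | None => u None end) hP).
by coordf_tac.
Qed.

Lemma dpred_fiber1 (V : Type) (P : (V -> M) -> M -> Prop) (v : V -> M) :
  dpred S (fun u : option V -> M => P (fun i => u (Some i)) (u None)) ->
  dpred S (fun u : unit -> M => P v (u tt)).
Proof.
move=> hP.
apply: (dpred_app (t := fun u x => if x is Some i then v i else u tt) hP).
by coordf_tac.
Qed.

Lemma itv_avoid (x : M) (s : seq M) : exists a b, (a < x < b)%O /\
  forall y, (a < y < b)%O -> y \in s -> y = x.
Proof.
elim: s => [|z s [a [b [axb h]]]].
  by have [a [b axb]] := itv_ex M_dlo x; exists a, b.
have [a' [b' [axb' h']]] : exists a b, (a < x < b)%O /\
    forall y, (a < y < b)%O -> y = z -> y = x.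
  have [a' [b' /andP[ax xb]]] := itv_ex M_dlo x.
  case: (ltgtP x z) => [xz|zx|->].
  - exists a', z; rewrite ax xz; split=> // y /andP[_ yz] yz'.
    by rewrite yz' ltxx in yz.
  - exists z, b'; rewrite zx xb; split=> // y /andP[yz _] yz'.
    by rewrite yz' ltxx in yz.
  - have [a1 [b1 h1]] := itv_ex M_dlo z.
    by exists a1, b1; split.
have [c [d [cxd k]]] := oo_itvI axb axb'; exists c, d; split=> // y /k[y1 y2].
by rewrite inE => /predU1P[|ys]; [exact: h'|exact: h].
Qed.

Context (S_visceral : locally_l_visceral S).

(** Near x the set Q is the union of a finite set and an open set; the open part is empty since Q
    has no interior, and a smaller interval avoids the finite part except possibly x. As x is any
    point of M, Q is closed as well as discrete. *)
Lemma not_fat1_isolated (Q : M -> Prop) :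
  dpred S (fun u : unit -> M => Q (u tt)) -> ~ fat1 Q ->
  forall x, exists a b, (a < x < b)%O /\
    forall y, (a < y < b)%O -> Q y -> y = x.
Proof.
move=> hQ nQ x.
have dQ : definable1 S Q.
  apply/definable_pred; rewrite /pred_of/=.
  apply: dpred_ext (dpred_app (t := fun u _ => u ord0) hQ _).
    by move=> v; rewrite mxE.
  by coordf_tac.
have [I [oI xI [F [U [finF oU QI]]]]] := S_visceral x dQ.
have U0 y : ~ U y.
  move=> Uy; have /(nbhs_itv M_dlo)[a [b [ayb h]]] := open_nbhs_nbhs (conj oU Uy).
  apply: nQ; exists a, b, y; split=> // z /h Uz.
  suff : (F `|` U) z by rewrite -QI => -[].
  by right.
have [a [b [axb h]]] : exists a b, (a < x < b)%O /\
    forall y, (a < y < b)%O -> y \in I.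
  apply/(nbhs_itv M_dlo x [set y | y \in I]); rewrite itv_nbhsE.
  by exists I.
have /finite_seqP[s Fs] := finF.
have [a' [b' [axb' h']]] := itv_avoid x s.
have [c [d [cxd k]]] := oo_itvI axb axb'; exists c, d.
split=> // y /k[y1 y2] Qy; apply: h' => //.
have : (Q `&` [set` I]) y by split=> //; exact: h.
by rewrite QI Fs => -[//|/U0].
Qed.

(* R is closed and discrete: w need not lie in R. *)
Definition locfin (W : Type) (R : (W -> M) -> Prop) : Prop :=
  forall w, exists a b, box a b w /\
    forall w', box a b w' -> R w' -> w' = w.

(** Each coordinate image of R is isolated on an interval around the coordinate of w, and the
    product of these intervals is the required box. *)
Lemma locfin_coords (W : finType) (R : (W -> M) -> Prop) :
  dpred S R -> (forall j, ~ fat1 (fun y => exists2 w, R w & w j = y)) ->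
  locfin R.
Proof.
move=> hR nR w.
have /choice[p hp] : forall j, exists p : M * M, (p.1 < w j < p.2)%O /\
    forall y, (p.1 < y < p.2)%O -> (exists2 w, R w & w j = y) -> y = w j.
  move=> j; have [|a [b ab]] := @not_fat1_isolated _ _ (nR j) (w j);
    last by exists (a, b).
  apply: (@dpred_ext _ _ _ _ _ (fun u => exists w, R w /\ w j = u tt)).
    by move=> v; split=> [[w' []]|[w']]; exists w'.
  apply: (dpred_exs (M_neq0 M_dlo)); apply: dpred_and.
    by apply: (dpred_app (t := fun u j => u (inr j)) hR); coordf_tac.
  by apply: dpred_eq; coordf_tac.
exists (fun j => (p j).1), (fun j => (p j).2); split=> [j|w' bw' Rw'].
  by have [] := hp j.
by apply/funext => j; have [_] := hp j; apply; [exact: bw'|exists w'].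
Qed.

(** If P has no interior, then its only possible point near y is y itself, so Q fills an interval
    immediately to the right of y. *)
Lemma fat1_or (P Q : M -> Prop) :
  dpred S (fun u : unit -> M => P (u tt)) ->
  fat1 (fun y => P y \/ Q y) -> fat1 P \/ fat1 Q.
Proof.
move=> hP [a [b [y [ayb h]]]].
have [|nP] := pselect (fat1 P); [by left|right].
have [c [d [cyd k]]] := not_fat1_isolated hP nP y.
have [e [f [eyf g]]] := oo_itvI ayb cyd.
have /andP[_ yf] := eyf; have [z yzf] := lt_mid M_dlo yf.
exists y, f, z; split=> // t /andP[yt tf].
have /g[/h[Pt|//] ctd] : (e < t < f)%O.
  by rewrite tf andbT; apply: lt_trans yt; case/andP: eyf.
by move: (k _ ctd Pt) yt => ->; rewrite ltxx.
Qed.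

Context (S_B : property_B S).

(** This is property (B), moved from matrices to tuples indexed by V. *)
Lemma fat_fiber1 (V : finType) (P : (V -> M) -> M -> Prop) :
  dpred S (fun u : option V -> M => P (fun i => u (Some i)) (u None)) ->
  fat (fun v => fat1 (P v)) ->
  fat (fun u : option V -> M => P (fun i => u (Some i)) (u None)).
Proof.
move=> hP fP; pose n := #|V|.
pose pt (v : 'I_(n + 1) -> M) (i : V) := v (lshift 1 (enum_rank i)).
(* The second conjunct discards points with thin fibers, since (B) asks for interior in every fiber
   over the projection. *)
pose R (v : 'I_(n + 1) -> M) :=
  P (pt v) (v (rshift n ord0)) /\ fat1 (P (pt v)).
pose X := [set x : 'rV[M]_(n + 1) | R (x ord0)].
have hR : dpred S R.
  apply: dpred_and.
    apply: (dpred_app (t := fun v x => if x is Some i then pt v i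
      else v (rshift n ord0)) hP).
    by coordf_tac.
  by apply: (dpred_app (t := pt) (dpred_fat1 hP)); coordf_tac.
have dX : definable S X.
  by apply/definable_pred; apply: dpred_ext hR => v; rewrite /pred_of /X/= fun_row.
have XE x y : X (row_mx x (const_mx y)) <->
    P (fun i => x ord0 (enum_rank i)) y /\
    fat1 (P (fun i => x ord0 (enum_rank i))).
  rewrite /X /= /R row_mxEr mxE.
  rewrite (_ : pt _ = (fun i => x ord0 (enum_rank i)))//.
  by apply/funext => i; rewrite /pt row_mxEl.
have fX : fat (pred_of (lsubmx @` X)).
  apply: fat_sub (fat_ren enum_rankK fP) => v fv.
  have [a [b [y [ayb h]]]] := fv.
  have v' : (fun i => (\row_j v j)%R ord0 (enum_rank i)) =
      (fun i => v (enum_rank i)).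
    by apply/funext => i; rewrite mxE.
  exists (row_mx (\row_i v i)%R (const_mx y)); last by rewrite row_mxKl.
  by apply/XE; rewrite v'; split=> //; exact: h.
have {}fX : fat (pred_of X).
  apply/(interior_fat M_dlo); apply: S_B => //; first exact/(interior_fat M_dlo).
  move=> _ [x Xx <-]; apply/(interior_fat1 M_dlo).
  have [_] := Xx; apply: fat1_sub => y Py; apply/XE.
  rewrite (_ : (fun i => _) = pt (x ord0)); first by split=> //; case: Xx.
  by apply/funext => i; rewrite mxE.
pose f (i : 'I_(n + 1)) : option V :=
  match fintype.split i with inl j => Some (enum_val j) | inr _ => None end.
pose g (o : option V) : 'I_(n + 1) :=
  if o is Some i then lshift 1 (enum_rank i) else rshift n ord0.
have fK : cancel f g.
  move=> i; rewrite /f /g; case: splitP => j ij; apply: val_inj => /=.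
    by rewrite enum_valK.
  by rewrite ij ord1.
have gK : cancel g f.
  case=> [i|]; rewrite /f /g; case: splitP => j /= ij.
  - by congr Some; rewrite (_ : j = enum_rank i) ?enum_rankK//; exact: val_inj.
  - by have := ltn_ord (enum_rank i); rewrite ij ltnNge leq_addr.
  - by have := ltn_ord j; rewrite -ij addn0 ltnn.
  - by [].
apply: fat_sub (fat_ren fK fX) => u; rewrite /pred_of /X/= fun_row => -[+ _].
rewrite /pt (_ : f (rshift n ord0) = None); last exact: (gK None).
rewrite (_ : (fun i => _) = (fun i => u (Some i)))//.
by apply/funext => i; congr u; exact: (gK (Some i)).
Qed.

(** Property (B) is iterated over the coordinates of W. A box in the total set is a product of two
    boxes, so this makes a choice of w uniform in v. *)
Lemma fat_fiber (V W : finType) (P : (V -> M) -> (W -> M) -> Prop) :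
  dpred S (fun u : V + W -> M => P (fun i => u (inl i)) (fun j => u (inr j))) ->
  fat (fun v => fat (P v)) ->
  fat (fun u : V + W -> M => P (fun i => u (inl i)) (fun j => u (inr j))).
Proof.
elim/finType_option_ind: W V P => [W W' f [g fK gK] IH V P hP fP|V P hP fP|
    W IH V P hP fP].
- have :=
    IH V (fun v w => P v (fun j => w (g j))).
  have h : dpred S (fun u : V + W -> M => P (fun i => u (inl i))
      (fun j => u (inr (g j)))).
    apply: (dpred_app (t := fun u x => match x with
      inl i => u (inl i) | inr j => u (inr (g j)) end) hP).
    by coordf_tac.
  move=> /(_ h){}h; have {}h := h (fat_sub (fun v => @fat_ren _ _ _ _ _ _ _ gK) fP).
  pose F (x : V + W) : V + W' :=
    match x with inl i => inl i | inr j => inr (f j) end.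
  pose G (x : V + W') : V + W :=
    match x with inl i => inl i | inr j => inr (g j) end.
  have FK : cancel F G by case=> i //=; rewrite fK.
  apply: fat_sub (fat_ren FK h) => u /=.
  by rewrite (_ : (fun j => u (inr (f (g j)))) = (fun j => u (inr j)))//;
    apply/funext => j; rewrite gK.
- pose G (x : V + void) : V :=
    match x with inl i => i | inr j => match j with end end.
  have GK : cancel (@inl V void) G by [].
  apply: fat_sub (fat_ren GK fP) => u [a [b [w [_ h]]]].
  by rewrite (@fun_card0 _ _ (fun j => u (inr j)) w) ?card_void//; apply: h; case.
(* The coordinate [None] moves to the parameter side: [fat_fiber1] handles it, and the induction
   hypothesis handles the remaining coordinates. *)
- pose Q (u : option V -> M) (w : W -> M) :=
    P (fun i => u (Some i)) (optf w (u None)).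
  have hQ : dpred S (fun u : option V + W -> M => Q (fun i => u (inl i))
     (fun j => u (inr j))).
    apply: (dpred_app (t := fun u x => match x with inl i => u (inl (Some i))
      | inr (Some j) => u (inr j) | inr None => u (inl None) end) hP).
    by coordf_tac.
  pose F (x : option V + W) : V + option W := match x with
    inl (Some i) => inl i | inl None => inr None | inr j => inr (Some j) end.
  pose G (x : V + option W) : option V + W := match x with
    inl i => inl (Some i) | inr None => inl None | inr (Some j) => inr j end.
  have FK : cancel F G by case=> [[i|]|j].
  have fQ : fat (fun u => fat (Q u)).
    have /fat_sub : forall u : option V -> M,
      fat (fun w => P (fun i => u (Some i)) (optf w (u None))) -> fat (Q u) by [].
    apply; apply: (@fat_fiber1 V (fun v y => fat (fun w => P v (optf w y)))).
      exact: (dpred_fat hQ).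
    apply: fat_sub fP => v [a [b [w [abw h]]]].
    exists (a None), (b None), (w None); split=> [|y aby]; first exact: abw.
    exists (fun j => a (Some j)), (fun j => b (Some j)), (fun j => w (Some j)).
    split=> [j|w' abw']; first exact: abw.
    by apply: h; case=> [j|//]; exact: abw'.
  have {}fQ := IH _ _ hQ fQ.
  apply: fat_sub (fat_ren FK fQ) => u; rewrite /Q/=.
  by rewrite (_ : optf _ _ = (fun j => u (inr j)))//; apply/funext => -[].
Qed.

(** By induction on V: over each point of a box the last coordinate is settled by [fat1_or], the
    induction hypothesis makes one alternative hold on an open set, and (B) reassembles the
    coordinates. *)
Lemma fat_or (V : finType) (P Q : (V -> M) -> Prop) :
  dpred S P -> dpred S Q -> fat (fun v => P v \/ Q v) -> fat P \/ fat Q.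
Proof.
elim/finType_option_ind: V P Q => [V W f [g fK gK] IH P Q hP hQ fPQ|P Q hP hQ fPQ|
    V IH P Q hP hQ fPQ].
- have h R : dpred S R -> dpred S (fun v => R (fun j => v (g j))).
    by move=> hR; apply: (dpred_app hR); coordf_tac.
  have := IH _ _ (h _ hP) (h _ hQ) (fat_ren gK fPQ).
  have h' (R : (W -> M) -> Prop) : fat (fun v => R (fun j => v (g j))) -> fat R.
    move=> fR; apply: fat_sub (fat_ren fK fR) => w.
    by rewrite (_ : (fun j => _) = w)//; apply/funext => j; rewrite gK.
  by case=> /h'; [left|right].
- have [a [b [v [abv /(_ _ abv)]]]] := fPQ.
  by case=> p; [left|right]; exists a, b, v; split=> // w _;
    rewrite (@fun_card0 _ _ w v) ?card_void.
- have h (R : (option V -> M) -> Prop) : dpred S R -> dpred S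
      (fun u : option V -> M => R (optf (fun i => u (Some i)) (u None))).
    by move=> hR; apply: dpred_ext hR => u; rewrite optfK.
  have : fat (fun v =>
      fat1 (fun y => P (optf v y)) \/ fat1 (fun y => Q (optf v y))).
    have [a [b [v [abv k]]]] := fPQ.
    exists (fun i => a (Some i)), (fun i => b (Some i)), (fun i => v (Some i)).
    split=> [i|w abw]; first exact: abv.
    apply: fat1_or.
      exact: (@dpred_fiber1 _ (fun v y => P (optf v y)) w (h _ hP)).
    exists (a None), (b None), (v None); split=> [|y aby]; first exact: abv.
    by apply: k; case=> [i|//]; exact: abw.
  have h' (R : (option V -> M) -> Prop) : dpred S R ->
      fat (fun v => fat1 (fun y => R (optf v y))) -> fat R.
    move=> hR /(fat_fiber1 (h _ hR)); apply: fat_sub => u.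
    by rewrite optfK.
  case/IH => [||/(h' _ hP)|/(h' _ hQ)].
  - exact: (@dpred_fat1 _ (fun v y => P (optf v y)) (h _ hP)).
  - exact: (@dpred_fat1 _ (fun v y => Q (optf v y)) (h _ hQ)).
  - by left.
  - by right.
Qed.

(** This is how generic points are obtained: an exceptional set without interior can be removed. *)
Lemma fat_minus (V : finType) (P Q : (V -> M) -> Prop) :
  dpred S P -> dpred S Q -> fat P -> ~ fat Q -> fat (fun v => P v /\ ~ Q v).
Proof.
move=> hP hQ fP nQ.
have [||//|//] := @fat_or V (fun v => P v /\ ~ Q v) Q _ hQ.
  by apply: dpred_and => //; exact: dpred_not.
apply: fat_sub fP => v Pv; have [|] := pselect (Q v); by [right|left].
Qed.

Lemma fat_exfin (V I : finType) (P : I -> (V -> M) -> Prop) :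
  (forall i, dpred S (P i)) -> fat (fun v => exists i, P i v) ->
  exists i, fat (P i).
Proof.
move=> hP fP.
have h (s : seq I) : fat (fun v => exists2 i, i \in s & P i v) ->
    exists i, fat (P i).
  elim: s => [|j s IH] fs; first by have [a [b [v [abv /(_ _ abv)[]]]]] := fs.
  have [||fj|/IH//] := @fat_or V (P j) (fun v => exists2 i, i \in s & P i v) (hP j).
  - apply: (@dpred_ext _ _ _ _ _ (fun v => exists i, i \in s /\ P i v)).
      by move=> v; split=> [[i []]|[i]]; exists i.
    have M0 := M_neq0 M_dlo.
    by apply: (dpred_exfin M0) => i; apply: dpred_and => //; exact: dpred_const.
  - apply: fat_sub fs => v [i]; rewrite inE => /predU1P[->|si] p; first by left.
    by right; exists i.
  - by exists j.
apply: (h (enum I)); apply: fat_sub fP => v [i p]; exists i => //.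
by rewrite mem_enum.
Qed.
End visceral.

(** * Definable selection and continuity on smaller boxes *)

Section definable_maps.
Context {disp : Order.disp_t} {M : orderTopologicalType disp}.
Context {L : language} {S : fo_structure L M}.
Context (M_dlo : dense_no_endpoints M).

Lemma row_mx_fun n m (v : 'I_n -> M) (w : 'I_m -> M) :
  row_mx (\row_i v i)%R (\row_j w j)%R =
  (\row_k match fintype.split k with inl i => v i | inr j => w j end)%R.
Proof.
by apply/rowP => k; rewrite !mxE; case: fintype.split => i; rewrite mxE.
Qed.

Lemma dfun_definable_map n m (X : set 'rV[M]_n) (f : 'rV[M]_n -> 'rV[M]_m) :
  definable_map S X f ->
  forall j, dfun S (pred_of X) (fun v => f (\row_i v i)%R ord0 j).
Proof.
move=> /definable_pred hG j; rewrite /dfun.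
set G := pred_of _ in hG.
apply: (@dpred_ext _ _ _ _ _ (fun u => exists w : 'I_m -> M,
    G (fun k => match fintype.split k with
      inl i => u (Some i) | inr j => w j end) /\
    w j = u None)).
  move=> u; rewrite /G /pred_of; split=> [[w []]|[Xu fu]].
    rewrite -row_mx_fun => -[x Xx /eq_row_mx[xu fw] wu].
    by rewrite -xu; split=> //; rewrite fw mxE.
  exists (f (\row_i u (Some i))%R ord0); split=> //.
  by rewrite -row_mx_fun row_fun; eexists; first exact: Xu.
apply: (dpred_exs (M_neq0 M_dlo)); apply: dpred_and.
  apply: (dpred_app (t := fun u k => match fintype.split k with
    inl i => u (inl (Some i)) | inr j => u (inr j) end) hG) => k.
  by case: fintype.split; coordf_tac.
by apply: dpred_eq; coordf_tac.
Qed.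

Lemma definable_map_dfun n m (X : set 'rV[M]_n) (f : 'rV[M]_n -> 'rV[M]_m) :
  dpred S (pred_of X) ->
  (forall j, dfun S (pred_of X) (fun v => f (\row_i v i)%R ord0 j)) ->
  definable_map S X f.
Proof.
move=> hX hf; apply/definable_pred.
apply: (@dpred_ext _ _ _ _ _ (fun u : 'I_(n + m) -> M =>
  pred_of X (fun i => u (lshift m i)) /\ forall j,
  pred_of X (fun i => u (lshift m i)) /\
  f (\row_i u (lshift m i))%R ord0 j = u (rshift n j))).
  move=> u; rewrite /pred_of; split=> [[Xu /all_and2[_ fu]]|[x Xx xu]].
    exists (\row_i u (lshift m i))%R => //; apply/rowP => k; rewrite !mxE.
    case: splitP => i ki; rewrite ?mxE ?fu; congr u; exact: val_inj.
  have -> : (\row_i u (lshift m i))%R = x.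
    by apply/rowP => i; rewrite mxE; have /rowP/(_ (lshift m i)) := xu;
      rewrite row_mxEl mxE.
  split=> // j; split=> //.
  by have /rowP/(_ (rshift n j)) := xu; rewrite row_mxEr mxE.
apply: dpred_and; first by apply: (dpred_app hX); coordf_tac.
apply: (dpred_allfin (M_neq0 M_dlo)) => j.
apply: (dpred_app (t := fun u x => if x is Some i then u (lshift m i)
  else u (rshift n j)) (hf j)).
by coordf_tac.
Qed.

Lemma dpred_boxc (V : finType) (a b : V -> M) : dpred S (box a b).
Proof.
by apply: (@dpred_box _ _ M_dlo _ _ _ _ (fun=> a) (fun=> b) id) => i;
  coordf_tac.
Qed.

Context (S_visceral : locally_l_visceral S) (S_B : property_B S).
Context (S_d : property_d S).

(** If the fibers have interior over an open set, then by (B) P contains a product box and a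
    constant selects. Otherwise, over a smaller box, the fibers are nonempty without interior, hence
    discrete, and (d) provides the selection. *)
Lemma select1 (V : finType) (P : (V -> M) -> M -> Prop) :
  dpred S (fun u : option V -> M => P (fun i => u (Some i)) (u None)) ->
  fat (fun v => exists y, P v y) ->
  exists a b v0 g, [/\ box a b v0, dfun S (box a b) g
    & forall v, box a b v -> P v (g v)].
Proof.
move=> hP fP.
have [/(fat_fiber1 M_dlo S_B hP)/fat_opt|nP] :=
    pselect (fat (fun v => fat1 (P v))).
  move=> [a [b [v [c [d [y [abv cdy h]]]]]]].
  exists a, b, v, (fun=> y); split=> // [|w abw]; last exact: h.
  by apply: dfun_coord; [exact: dpred_boxc|coordf_tac].
have [||a [b [v0 [abv0 hE]]]] := fat_minus M_dlo S_visceral S_B _ _ fP nP.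
- exact: dpred_ex.
- exact: dpred_fat1.
pose n := #|V|.
pose pt (x : 'I_(n + 1) -> M) (i : V) := x (lshift 1 (enum_rank i)).
pose R (x : 'I_(n + 1) -> M) := box a b (pt x) /\ P (pt x) (x (rshift n ord0)).
pose X := [set x : 'rV[M]_(n + 1) | R (x ord0)].
have dX : definable S X.
  apply/definable_pred; apply: (@dpred_ext _ _ _ _ _ R).
    by move=> x; rewrite /pred_of /X/= fun_row.
  apply: dpred_and.
    by apply: (dpred_app (t := pt) (dpred_boxc a b)); coordf_tac.
  apply: (dpred_app (t := fun v x => if x is Some i then pt v i
      else v (rshift n ord0)) hP).
  by coordf_tac.
have [] := @S_d _ n X (@lshift n 1) dX.
- by move=> i j.
- move=> x _ z [Xz zx]; split; first exact/mem_set.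
  have [abz Pz] := Xz; have [_ nf] := hE _ abz.
  have [c [d [cdz k]]] := not_fat1_isolated M_dlo S_visceral
    (dpred_fiber1 (pt (z ord0)) hP) nf (z ord0 (rshift n ord0)).
  (* A condition on the last coordinate alone isolates z, since the other coordinates are constant
     on the fiber. *)
  exists [set z' : 'rV[M]_(n + 1) | (c < z' ord0 (rshift n ord0) < d)%O].
    have [a' [b' abz']] := box_ex M_dlo (z ord0).
    apply/(nbhs_box M_dlo).
    exists (fun i => if i == rshift n ord0 then c else a' i),
      (fun i => if i == rshift n ord0 then d else b' i); split=> [i|y].
      by case: eqP => [->//|_]; exact: abz'.
    by move/(_ (rshift n ord0)); rewrite eqxx.
  apply/seteqP; split=> [z' /= [cdz' [[abz' Pz'] z'x]]|z' /= ->]; last by split.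
  have ptE : pt (z' ord0) = pt (z ord0).
    apply/funext => i; have /rowP/(_ (enum_rank i)) := etrans z'x (esym zx).
    by rewrite !mxE.
  apply/rowP => i; rewrite -(splitK i); case: (fintype.split i) => j /=.
    by have /rowP/(_ j) := etrans z'x (esym zx); rewrite !mxE.
  by rewrite ord1; apply: k => //; rewrite -ptE.
move=> tau [/dfun_definable_map/(_ (rshift n ord0)) htau tauX].
pose e (v : V -> M) : 'rV[M]_n := (\row_i v (enum_val i))%R.
have eX v : box a b v -> (colsub (@lshift n 1) @` X) (e v).
  move=> abv; have [[y Pvy] _] := hE _ abv.
  exists (row_mx (e v) (const_mx y)).
    have ptE : pt (row_mx (e v) (const_mx y) ord0) = v.
      by apply/funext => i; rewrite /pt row_mxEl mxE enum_rankK.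
    by rewrite /X/= /R ptE row_mxEr mxE.
  by apply/rowP => i; rewrite mxE row_mxEl.
exists a, b, v0, (fun v => tau (e v) ord0 (rshift n ord0)); split=> //.
  apply: (dfun_comp (M_neq0 M_dlo) (dpred_boxc a b) _ _ htau
    (t := fun v i => v (enum_val i))) => [w|v].
    by apply: dfun_coord; [exact: dpred_boxc|coordf_tac].
  exact: eX.
move=> v /eX/tauX[[+ +] tauv].
rewrite (_ : pt _ = v)//; apply/funext => i; rewrite /pt.
by have /rowP/(_ (enum_rank i)) := tauv; rewrite !mxE enum_rankK.
Qed.

Lemma select (W V : finType) (P : (V -> M) -> (W -> M) -> Prop) :
  dpred S (fun u : V + W -> M => P (fun i => u (inl i)) (fun j => u (inr j))) ->
  fat (fun v => exists w, P v w) ->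
  exists a b v0 tau, [/\ box a b v0, forall j, dfun S (box a b) (tau^~ j)
    & forall v, box a b v -> P v (tau v)].
Proof.
have M0 := M_neq0 M_dlo.
elim/finType_option_ind: W V P => [W W' f [g fK gK] IH V P hP fP|V P hP fP|
    W IH V P hP fP].
- have [||a [b [v [tau [abv htau Ptau]]]]] :=
    IH V (fun v w => P v (fun j => w (g j))).
  + apply: (dpred_app (t := fun u x => match x with
      inl i => u (inl i) | inr j => u (inr (g j)) end) hP).
    by coordf_tac.
  + apply: fat_sub fP => v [w Pw]; exists (fun j => w (f j)).
    by rewrite (_ : (fun j => _) = w)//; apply/funext => j; rewrite gK.
  by exists a, b, v, (fun v j => tau v (g j)); split.
- have [a [b [v [abv h]]]] := fP.
  exists a, b, v, (fun=> of_void M); split=> [//|[]|w /h[z]].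
  by rewrite (@fun_card0 _ _ z (of_void M)) ?card_void.
(* The coordinate [None] is selected first, among the values that extend to a full tuple. *)
- have [||a [b [v0 [g [abv0 hg Pg]]]]] :=
    @select1 V (fun v y => exists w, P v (optf w y)).
  + apply: (dpred_exs M0).
    apply: (dpred_app (t := fun u x => match x with inl i => u (inl (Some i))
      | inr (Some j) => u (inr j) | inr None => u (inl None) end) hP).
    by coordf_tac.
  + apply: fat_sub fP => v [w Pvw]; exists (w None), (fun j => w (Some j)).
    by rewrite optfK.
  (* The conjunct [box a b v] keeps the new box inside the domain of g. *)
  have [||a' [b' [v1 [tau [abv1 htau Ptau]]]]] :=
    IH V (fun v w => box a b v /\ P v (optf w (g v))).
  + pose Q (u : V + W -> M) := box a b (fun i => u (inl i)).
    have hQ : dpred S Q by apply: (dpred_app (dpred_boxc a b)); coordf_tac.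
    apply: (dpred_comp M0 (t := fun u x => match x with inl i => u (inl i)
      | inr (Some j) => u (inr j) | inr None => g (fun i => u (inl i)) end)
      hQ _ hP) => -[i|[j|]].
    * by apply: dfun_coord => //; coordf_tac.
    * by apply: dfun_coord => //; coordf_tac.
    * apply: (dfun_comp M0 (t := fun u i => u (inl i)) hQ _ _ hg) => // i.
      by apply: dfun_coord => //; coordf_tac.
  + by exists a, b, v0; split=> // v abv; have [w] := Pg _ abv; exists w.
  have sub v : box a' b' v -> box a b v by move=> /Ptau[].
  exists a', b', v1, (fun v => optf (tau v) (g v)); split=> // [|v /Ptau[]//].
  case=> [j|]; first exact: htau.
  by apply: dfun_sub hg => //; exact: dpred_boxc.
Qed.

(** Continuity at v of the restriction of f to D, tested on bounded intervals. *)
Definition contat (V : Type) (D : (V -> M) -> Prop) (f : (V -> M) -> M) v :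
    Prop :=
  forall c d, (c < f v < d)%O -> exists a b, box a b v /\
    forall w, box a b w -> D w -> (c < f w < d)%O.

Lemma open_box_nbhs n (B : set 'rV[M]_n) x : open_box B -> B x ->
  exists a b, box a b (x ord0) /\ forall y : 'rV[M]_n, box a b (y ord0) -> B y.
Proof.
move=> [I oI ->] xI; apply/(nbhs_box M_dlo).
exists (fun _ j => [set` I j]); last by move=> y hy j; exact: hy.
move=> i j; rewrite ord1; apply: open_nbhs_nbhs; split; last exact: xI.
exact: itv_open_ends_open.
Qed.

Lemma box_open_box n (a b : 'I_n -> M) :
  open_box [set x : 'rV[M]_n | box a b (x ord0)].
Proof.
exists (fun i => `]a i, b i[%O); first by move=> i; rewrite /itv_open_ends/= ?orbT.
by apply/seteqP; split=> x /= h i; have := h i; rewrite in_itv.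
Qed.

Context (S_cont : star_continuity S).

Lemma Mpt_lt (x y : M) : (Mpt S x < Mpt S y)%O = (x < y)%O.
Proof. by rewrite !ltNge. Qed.

Lemma continuous_subbox1 (V : finType) (a b v : V -> M) f :
  box a b v -> dfun S (box a b) f -> exists a' b' v',
  [/\ box a' b' v', forall w, box a' b' w -> box a b w
    & forall w, box a' b' w -> contat (box a' b') f w].
Proof.
move=> abv hf; pose n := #|V|.
pose A i := a (@enum_val V V i); pose B i := b (@enum_val V V i).
pose r (x : 'rV[M]_n) (i : V) := x ord0 (enum_rank i).
pose C := [set x : 'rV[M]_n | box A B (x ord0)].
have Cr x : C x -> box a b (r x).
  by move=> h i; have := h (enum_rank i); rewrite /A /B enum_rankK.
pose F (x : 'rV[M]_n) := Mpt S (f (r x)).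
have [|||U [oU [u Uu] UC cF]] := @S_cont n C F; first exact: box_open_box.
- by exists (\row_i v (enum_val i))%R => i; rewrite mxE; exact: abv.
- exists [set z : 'rV[M]_(n + 1) | C (lsubmx z) /\
    f (r (lsubmx z)) = z ord0 (rshift n ord0)]; split.
  + apply/definable_pred.
    apply: dpred_ext (dpred_app (t := fun z x => if x is Some i then
      z (lshift 1 (enum_rank i)) else z (rshift n ord0)) hf _).
      move=> z; rewrite /pred_of/= mxE.
      have -> : r (lsubmx (\row_i z i)%R) = (fun i => z (lshift 1 (enum_rank i))).
        by apply/funext => i; rewrite /r !mxE.
      split=> -[h ->]; split=> // i; last first.
        by have := h (enum_rank i); rewrite /A /B !mxE enum_rankK.
      by have := h (enum_val i); rewrite enum_valK !mxE.
    by coordf_tac.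
  + apply/seteqP; split=> [_ [z [Cz _] <-]//|x Cx].
    exists (row_mx x (const_mx (f (r x)))); last by rewrite row_mxKl.
    by rewrite /= row_mxKl row_mxEr mxE.
  + move=> x Cx; rewrite (_ : fiber _ x = [set f (r x)]).
      rewrite image_set1; split; first by move=> _ ->; exact: lexx.
      by move=> y; apply.
    apply/seteqP; split=> y; rewrite /fiber/= row_mxKl row_mxEr mxE; first by case.
    by move=> ->.
have [a' [b' [abu h]]] := open_box_nbhs oU Uu.
exists (fun i => a' (enum_rank i)), (fun i => b' (enum_rank i)), (r u).
have hU w : box (fun i => a' (enum_rank i)) (fun i => b' (enum_rank i)) w ->
    U (\row_i w (enum_val i))%R.
  by move=> abw; apply: h => i; rewrite mxE; have := abw (enum_val i);
    rewrite enum_valK.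
have rE w : r (\row_i w (enum_val i))%R = w.
  by apply/funext => i; rewrite /r mxE enum_rankK.
split=> [i|w /hU/UC/Cr|w abw c d cd]; first exact: abu.
  by rewrite rE.
(* Intervals with endpoints in M are open in [Mbar S], so continuity into [Mbar S] gives continuity
   into M. *)
have nF : nbhs (F (\row_i w (enum_val i))%R : order_topology (Mbar S))
    [set y : order_topology (Mbar S) | (Mpt S c < y < Mpt S d)%O].
  rewrite itv_nbhsE; exists (`]Mpt S c, Mpt S d[%O).
    split; first by rewrite /itv_open_ends/= ?orbT.
    by rewrite in_itv/= /F rE !Mpt_lt.
  by move=> y; rewrite /= in_itv.
have /subspace_continuousP/(_ _ (hU _ abw)) := cF.
move=> /(_ _ nF); rewrite nbhs_filterE => /(nbhs_box M_dlo)[p [q [pqw k]]].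
exists (fun i => p (enum_rank i)), (fun i => q (enum_rank i)).
split=> [i|z pqz abz].
  by have := pqw (enum_rank i); rewrite mxE enum_rankK.
have k' (y : 'rV[M]_n) : box p q (y ord0) -> U y -> (c < f (r y) < d)%O.
  by move=> /k{}k /k; rewrite -!Mpt_lt.
rewrite -(rE z); apply: k'; last exact: hU.
by move=> i; rewrite mxE; have := pqz (enum_val i); rewrite enum_valK.
Qed.

Lemma continuous_subbox (V W : finType) (a b v : V -> M)
    (f : (V -> M) -> W -> M) :
  box a b v -> (forall j, dfun S (box a b) (f^~ j)) -> exists a' b' v',
  [/\ box a' b' v', forall w, box a' b' w -> box a b w
    & forall w j, box a' b' w -> contat (box a' b') (f^~ j) w].
Proof.
move=> abv hf.
suff h (s : seq W) : exists a' b' v', [/\ box a' b' v',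
    forall w, box a' b' w -> box a b w
    & forall w j, j \in s -> box a' b' w -> contat (box a' b') (f^~ j) w].
  have [a' [b' [v' [abv' sub c]]]] := h (enum W); exists a', b', v'; split=> //.
  by move=> w j; apply: c; rewrite mem_enum.
elim: s => [|j s [a1 [b1 [v1 [abv1 sub1 c1]]]]]; first by exists a, b, v; split.
have [|a2 [b2 [v2 [abv2 sub2 c2]]]] := @continuous_subbox1 _ a1 b1 v1 (f^~ j) abv1.
  by apply: dfun_sub (hf j) => //; exact: dpred_boxc.
exists a2, b2, v2; split=> // [w /sub2/sub1//|w k].
rewrite inE => /predU1P[->|ks] abw; first exact: c2.
move=> c d /(c1 _ _ ks (sub2 _ abw))[p [q [pqw h]]].
by exists p, q; split=> // z pqz /sub2; exact: h.
Qed.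
End definable_maps.

(** * Dimension, local sections, and fibers of definable maps *)

Section dimension.
Context {disp : Order.disp_t} {M : orderTopologicalType disp}.
Context {L : language} {S : fo_structure L M}.
Context (M_dlo : dense_no_endpoints M).

Definition projp (V U : Type) (s : V -> U) (P : (U -> M) -> Prop) (v : V -> M) :=
  exists2 u, P u & forall i, u (s i) = v i.

(* dim P >= k. The projection may permute the coordinates: s is only
   injective. *)
Definition has_dim (U : Type) (P : (U -> M) -> Prop) (k : nat) : Prop :=
  exists s : 'I_k -> U, injective s /\ fat (projp s P).

Lemma has_dim_card (V : finType) (U : Type) (s : V -> U)
    (P : (U -> M) -> Prop) :
  injective s -> fat (projp s P) -> has_dim P #|V|.
Proof.
move=> sI fP; exists (fun i => s (enum_val i)).
split; first by apply: inj_comp => //; exact: enum_val_inj.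
apply: fat_sub (fat_ren enum_rankK fP) => v [u Pu uv]; exists u => // i.
by rewrite uv enum_valK.
Qed.

Lemma has_dim_le (U : Type) (P : (U -> M) -> Prop) k l :
  (k <= l)%N -> has_dim P l -> has_dim P k.
Proof.
move=> kl [s [sI fP]]; exists (fun i => s (widen_ord kl i)).
have wI : injective (widen_ord kl).
  by move=> i j /(congr1 val) ij; exact: val_inj.
split; first exact: inj_comp.
apply: fat_sub (fat_inj wI fP) => v [w [u Pu uw] wv]; exists u => // i.
by rewrite uw wv.
Qed.

Lemma has_dim_sub (U : Type) (P Q : (U -> M) -> Prop) k :
  (forall u, P u -> Q u) -> has_dim P k -> has_dim Q k.
Proof.
move=> PQ [s [sI fP]]; exists s; split=> //.
by apply: fat_sub fP => v [u /PQ Qu uv]; exists u.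
Qed.

Lemma has_dim0 (U : Type) (P : (U -> M) -> Prop) u : P u -> has_dim P 0.
Proof.
move=> Pu; exists (fun i : 'I_0 =>
  match i with Ordinal _ h => match notF h with end end).
split; first by case.
have [c _] := M_neq0 M_dlo.
exists (fun=> c), (fun=> c), (fun=> c); split; first by case.
by move=> w _; exists u => // -[].
Qed.

Lemma fat_ex (V : Type) (P : (V -> M) -> Prop) : fat P -> exists v, P v.
Proof. by move=> [a [b [v [abv h]]]]; exists v; exact: h. Qed.

Lemma fat1_two (Q : M -> Prop) : fat1 Q -> exists y z, [/\ Q y, Q z & y <> z].
Proof.
move=> [a [b [y [ayb h]]]]; have /andP[ay yb] := ayb.
have [z /andP[yz zb]] := lt_mid M_dlo yb; exists y, z; split.
- exact: h.
- by apply: h; rewrite zb (lt_trans ay yz).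
- by move=> yz'; rewrite yz' ltxx in yz.
Qed.

Lemma dpred_projp (V : Type) (U : finType) (V' : finType) (s : V' -> U)
    (P : (U -> M) -> Prop) (t : (V -> M) -> V' -> M) :
  dpred S P -> (forall i, coordf (t^~ i)) ->
  dpred S (fun v => projp s P (t v)).
Proof.
move=> hP ht; have M0 := M_neq0 M_dlo.
apply: (@dpred_ext _ _ _ _ _ (fun v => exists u, P u /\ forall i, u (s i) = t v i)).
  by move=> v; split=> -[u]; [case=> Pu uv|]; exists u.
apply: (dpred_exs M0); apply: dpred_and.
  by apply: (dpred_app hP); coordf_tac.
apply: (dpred_allfin M0) => i; apply: dpred_eq; first by coordf_tac.
by case: (ht i) => -[c e]; [left; exists (inl c)|right; exists c];
  apply/funext => u; exact: (congr1 (fun h => h _) e).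
Qed.

Context (S_visceral : locally_l_visceral S) (S_B : property_B S).

(** A fiber that is not bad is closed and discrete ([not_bad_locfin]), and badness is a definable
    condition on v. *)
Definition bad_fiber (V U : Type) (s : V -> U) (P : (U -> M) -> Prop)
    (v : V -> M) : Prop :=
  exists j, fat1 (fun y => exists2 u, P u /\ (forall i, u (s i) = v i) & u j = y).

Lemma dpred_fiber_coord (V U : finType) (s : V -> U) (P : (U -> M) -> Prop) j :
  dpred S P -> dpred S (fun w : option V -> M =>
    exists2 u, P u /\ (forall i, u (s i) = w (Some i)) & u j = w None).
Proof.
move=> hP; have M0 := M_neq0 M_dlo.
apply: (@dpred_ext _ _ _ _ _ (fun w : option V -> M =>
    exists u, (P u /\ (forall i, u (s i) = w (Some i))) /\ u j = w None)).
  by move=> v; split=> -[u]; [case=> Pu uv|]; exists u.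
apply: (dpred_exs M0); apply: dpred_and; last by apply: dpred_eq; coordf_tac.
apply: dpred_and; first by apply: (dpred_app hP); coordf_tac.
by apply: (dpred_allfin M0) => i; apply: dpred_eq; coordf_tac.
Qed.

Lemma dpred_bad_fiber (V U : finType) (s : V -> U) (P : (U -> M) -> Prop) :
  dpred S P -> dpred S (bad_fiber s P).
Proof.
move=> hP; apply: (dpred_exfin (M_neq0 M_dlo)) => j; apply: dpred_fat1.
exact: dpred_fiber_coord.
Qed.

(** If the bad points had interior, one coordinate j would serve on an open set, and by (B) the
    projection to the coordinates s together with j would have interior, exceeding the dimension
    bound. *)
Lemma bad_fiber_not_fat (V U : finType) (s : V -> U) (P : (U -> M) -> Prop) :
  dpred S P -> injective s -> ~ has_dim P #|V|.+1 -> ~ fat (bad_fiber s P).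
Proof.
move=> hP sI ndim /(fat_exfin M_dlo S_visceral S_B)[i|j fj].
  by apply: dpred_fat1; exact: dpred_fiber_coord.
apply: ndim; rewrite -card_option.
pose s' (o : option V) := if o is Some i then s i else j.
apply: (@has_dim_card _ _ s'); last first.
  apply: fat_sub (fat_fiber1 M_dlo S_B (dpred_fiber_coord s j hP) fj) => w.
  by move=> [u [Pu us] uj]; exists u => // -[].
(* On a fiber the coordinates in the image of s are constant, whereas coordinate j takes two
   values. *)
have js i : j <> s i.
  have [v /fat1_two[y [z [[u [_ us] uj] [u' [_ us'] uj'] yz]]]] := fat_ex fj.
  by move=> jsi; apply: yz; rewrite -uj -uj' jsi us us'.
by case=> [i|] [i'|] //= => [/sI->//|e|/js//]; case: (js i).
Qed.

Lemma not_bad_locfin (V U : finType) (s : V -> U) (P : (U -> M) -> Prop) v :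
  dpred S P -> ~ bad_fiber s P v ->
  locfin (fun u => P u /\ forall i, u (s i) = v i).
Proof.
move=> hP nb; apply: (locfin_coords M_dlo S_visceral).
  apply: dpred_and => //; apply: (dpred_allfin (M_neq0 M_dlo)) => i.
  by apply: dpred_eq; coordf_tac.
by move=> j fj; apply: nb; exists j.
Qed.

(* z : U + U -> M encodes the two corners of a box around w. *)
Lemma fat_corners (U : finType) (c d w : U -> M)
    (R : (U + U -> M) -> Prop) :
  box c d w ->
  (forall z : U + U -> M, box (fun i => z (inl i)) (fun i => z (inr i)) w ->
    (forall u, box (fun i => z (inl i)) (fun i => z (inr i)) u -> box c d u) ->
    R z) ->
  fat R.
Proof.
move=> cdw h; have [|z bz] := @box_neq0 _ _ M_dlo _ (sumf c w) (sumf w d).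
  by case=> i /=; case/andP: (cdw i).
exists (sumf c w), (sumf w d), z; split=> // z' bz'; apply: h => [i|u bu i].
  by have /andP[_ ->] := bz' (inl i); have /andP[-> _] := bz' (inr i).
have /andP[c1 _] := bz' (inl i); have /andP[_ d1] := bz' (inr i).
have /andP[u1 u2] := bu i.
by rewrite (lt_trans c1 u1) (lt_trans u2 d1).
Qed.

Context (S_d : property_d S) (S_cont : star_continuity S).

(** Generic fibers of P are closed and discrete because of the dimension bound, so each point of a
    selected section of Q is alone in its P-fiber within some box, and by (B) one box from c to d
    serves for all v. Thus tau runs through Q while its image is relatively open in the larger set
    P. *)
Lemma local_section (V U : finType) (s : V -> U) (P Q : (U -> M) -> Prop) :
  dpred S P -> dpred S Q -> (forall u, Q u -> P u) -> injective s ->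
  ~ has_dim P #|V|.+1 -> fat (projp s Q) ->
  exists a b v0 tau c d,
  [/\ box a b v0, forall j, dfun S (box a b) (tau^~ j),
      forall v j, box a b v -> contat (box a b) (tau^~ j) v,
      forall v, box a b v ->
        [/\ Q (tau v), forall i, tau v (s i) = v i & box c d (tau v)]
    & forall u, P u -> box c d u -> box a b (fun i => u (s i)) ->
        u = tau (fun i => u (s i))].
Proof.
move=> hP hQ QP sI ndim fQ; have M0 := M_neq0 M_dlo.
have hsQ : dpred S (projp s Q) by apply: dpred_projp hQ _; coordf_tac.
have nb := bad_fiber_not_fat hP sI ndim.
have fE := fat_minus M_dlo S_visceral S_B hsQ (dpred_bad_fiber s hP) fQ nb.
have [||a [b [v0 [tau [abv0 htau Ptau]]]]] := @select _ _ _ S M_dlo S_visceral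
  S_B S_d _ _ (fun v u => (Q u /\ forall i, u (s i) = v i) /\ ~ bad_fiber s P v).
- apply: dpred_and; last first.
    apply/dpred_not/(dpred_app (t := fun u i => u (inl i)) (dpred_bad_fiber s hP)).
    by coordf_tac.
  apply: dpred_and; first by apply: (dpred_app hQ); coordf_tac.
  by apply: (dpred_allfin M0) => i; apply: dpred_eq; coordf_tac.
- by apply: fat_sub fE => v [[u Qu us] nbv]; exists u.
(* w holds the corners of a box around [tau v] that contains no other point of the fiber of P over
   v. *)
pose R v (w : U + U -> M) := box a b v /\
  box (fun i => w (inl i)) (fun i => w (inr i)) (tau v) /\ forall u,
  P u -> (forall i, u (s i) = v i) ->
  box (fun i => w (inl i)) (fun i => w (inr i)) u -> forall j, u j = tau v j.
have hR : dpred S (fun x : V + (U + U) -> M =>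
    R (fun i => x (inl i)) (fun j => x (inr j))).
  (* [R0] is the condition with a free variable in place of [tau v]; tau is then substituted by
     [dpred_comp], over the box on which it is definable. *)
  pose R0 (y : (V + (U + U)) + U -> M) :=
    box (fun i => y (inl (inr (inl i)))) (fun i => y (inl (inr (inr i))))
      (fun j => y (inr j)) /\
    forall u, P u -> (forall i, u (s i) = y (inl (inl i))) ->
    box (fun i => y (inl (inr (inl i)))) (fun i => y (inl (inr (inr i)))) u ->
    forall j, u j = y (inr j).
  have hR0 : dpred S R0.
    apply: dpred_and; first by apply: (dpred_box M_dlo) => i; coordf_tac.
    apply: (dpred_alls M0); apply: dpred_imp.
      by apply: (dpred_app hP); coordf_tac.
    apply: dpred_imp.
      by apply: (dpred_allfin M0) => i; apply: dpred_eq; coordf_tac.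
    apply: dpred_imp; first by apply: (dpred_box M_dlo) => i; coordf_tac.
    by apply: (dpred_allfin M0) => i; apply: dpred_eq; coordf_tac.
  pose D (x : V + (U + U) -> M) := box a b (fun i => x (inl i)).
  have hD : dpred S D by apply: (dpred_app (dpred_boxc M_dlo a b)); coordf_tac.
  apply: (dpred_comp M0 (t := fun x => sumf x (tau (fun i => x (inl i)))) hD _ hR0).
  case=> [i|j]; first by apply: dfun_coord => //; coordf_tac.
  apply: (dfun_comp M0 (t := fun x i => x (inl i)) hD _ _ (htau j)) => // i.
  by apply: dfun_coord => //; coordf_tac.
have fR : fat (fun v => fat (R v)).
  exists a, b, v0; split=> // v abv; have [[Qv sv] nbv] := Ptau v abv.
  have [c [d [cdv h]]] := not_bad_locfin hP nbv (tau v).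
  apply: (fat_corners cdv) => z bz sub; split=> //; split=> // u Pu us bu j.
  by rewrite (h u (sub _ bu)).
(* A single pair of corners w now isolates [tau v] for every v in a smaller box. *)
have /fat_sum[a1 [b1 [v1 [c [d [w [abv1 cdw k]]]]]]] := fat_fiber M_dlo S_B hR fR.
have sub1 v : box a1 b1 v -> box a b v by move=> /k/(_ cdw)[].
have [|a2 [b2 [v2 [abv2 sub2 c2]]]] :=
    continuous_subbox M_dlo S_cont (f := tau) abv1.
  by move=> j; apply: dfun_sub (htau j) => //; exact: dpred_boxc.
exists a2, b2, v2, tau, (fun i => w (inl i)), (fun i => w (inr i)); split=> //.
- move=> j; apply: dfun_sub (htau j) => [|v /sub2/sub1//].
  exact: dpred_boxc.
- move=> v abv; have [[Qv sv] nbv] := Ptau v (sub1 _ (sub2 _ abv)); split=> //.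
  by have [_ []] := k _ _ (sub2 _ abv) cdw.
- move=> u Pu bu abu; have [_ [_ h]] := k _ _ (sub2 _ abu) cdw.
  by apply/funext => j; exact: h.
Qed.

(** A type with n elements for which adding a coordinate is [option] by computation, as the
    induction on n below requires. *)
Fixpoint optn (n : nat) : finType :=
  if n is m.+1 then option (optn m) else void.

Lemma card_optn n : #|optn n| = n.
Proof. by elim: n => [|n IH]; rewrite ?card_void// card_option IH. Qed.

(** By induction on n, according to whether f takes an interval of values as the last variable z
    moves. If so, z can be adjusted to keep f constant; if not, f is locally constant in z, and the
    problem descends to the other variables. *)
Lemma fiber_section n (a b v : option (optn n) -> M) f :
  box a b v -> dfun S (box a b) f ->
  exists t (a' b' v' : optn n -> M) tau, [/\ box a' b' v',
    forall j, dfun S (box a' b') (tau^~ j),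
    forall x, box a' b' x -> box a b (tau x) /\ f (tau x) = t
    & forall x y, box a' b' x -> box a' b' y -> tau x = tau y -> x = y].
Proof.
have M0 := M_neq0 M_dlo.
elim: n a b v f => [|n IH] a b v f abv hf.
  have [c _] := M0; exists (f v), (fun=> c), (fun=> c), (fun=> c), (fun=> v).
  split=> [[]|j|//|x y _ _ _].
    by apply: dfun_coord; [exact: dpred_boxc|coordf_tac].
  by apply: fun_card0; exact: card_void.
have [a1 [b1 [v1 [abv1 sub1 c1]]]] := continuous_subbox1 M_dlo S_cont abv hf.
have hf1 : dfun S (box a1 b1) f by apply: dfun_sub hf => //; exact: dpred_boxc.
pose V := optn n.+1.
pose G (x : V -> M) y z := box a1 b1 (optf x z) /\ f (optf x z) = y.
have hG : dpred S (fun u : option (option V) -> M =>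
    G (fun i => u (Some (Some i))) (u (Some None)) (u None)).
  apply: dpred_ext (dpred_app (t := fun u x => match x with None => u (Some None)
    | Some None => u None | Some (Some i) => u (Some (Some i)) end) hf1 _).
    move=> u; rewrite /G.
    by rewrite (_ : optf _ _ = (fun i => match i with Some i => u (Some (Some i))
      | None => u None end)).
  by coordf_tac.
(* First case: by (B) one value t is attained over every x in a box. Selecting z as a function g of
   x gives the section x |-> (x, g x), which is injective. *)
have [fA|nA] := pselect (fat (fun x => fat1 (fun y => exists z, G x y z))).
  have /(@fat_opt _ _ V (fun x y => exists z, G x y z))
      [a2 [b2 [v2 [c [d [t [abv2 cdt h]]]]]]] :=
    fat_fiber1 M_dlo S_B (P := fun x y => exists z, G x y z) (dpred_ex hG) fA.
  have [||a3 [b3 [v3 [g [abv3 hg k]]]]] := @select1 _ _ _ S M_dlo S_visceral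
      S_B S_d _ (fun x z => box a2 b2 x /\ G x t z).
  - apply: dpred_and.
      by apply: (dpred_app (dpred_boxc M_dlo a2 b2)); coordf_tac.
    apply: (dpred_app (t := fun u x => match x with None => u None
      | Some None => t | Some (Some i) => u (Some i) end) hG).
    by coordf_tac.
  - exists a2, b2, v2; split=> // x abx; have [z hz] := h x t abx cdt.
    by exists z.
  exists t, a3, b3, v3, (fun x => optf x (g x)); split=> //.
  - case=> [i|//]; apply: dfun_coord; first exact: dpred_boxc.
    by coordf_tac.
  - by move=> x /k[_ [/sub1]].
  - move=> x y _ _ xy; apply/funext => i.
    exact: (congr1 (fun h => h (Some i)) xy).
pose A (x : V -> M) := box (fun i => a1 (Some i)) (fun i => b1 (Some i)) x.
have hA : dpred S A by exact: dpred_boxc.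
have [||a2 [b2 [v2 [abv2 k2]]]] := fat_minus M_dlo S_visceral S_B hA _ _ nA.
- by apply: dpred_fat1; exact: dpred_ex hG.
- exists (fun i => a1 (Some i)), (fun i => b1 (Some i)), (fun i => v1 (Some i)).
  by split=> // i; exact: abv1.
have ab1 x z : box a2 b2 x -> (a1 None < z < b1 None)%O -> box a1 b1 (optf x z).
  by move=> /k2[Ax _] az [i|//]; exact: Ax.
pose z0 := v1 None; have abz0 : (a1 None < z0 < b1 None)%O by exact: abv1.
(* Second case: for z near z0, continuity keeps the value near that at z0, where the thin set of
   values has no other element. By (B) the equality then holds for all z in an interval independent
   of x. *)
pose P (x : V -> M) z := (box a2 b2 x /\ (a1 None < z < b1 None)%O) /\
  f (optf x z) = f (optf x z0).
have [|a3 [b3 [v3 [c3 [d3 [y3 [abv3 cdy3 k3]]]]]]] := @fat_opt _ _ V P.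
  apply: (fat_fiber1 M_dlo S_B).
    pose D (u : option V -> M) := box a2 b2 (fun i => u (Some i)) /\
      (a1 None < u None < b1 None)%O.
    have hD : dpred S D.
      apply: dpred_and.
        by apply: (dpred_app (dpred_boxc M_dlo a2 b2)); coordf_tac.
      by apply: dpred_itv; coordf_tac.
    have hR : dpred S (fun w : bool -> M => w true = w false).
      by apply: dpred_eq; coordf_tac.
    apply: dpred_ext (dpred_comp M0 (t := fun u (c : bool) =>
      if c then f u else f (optf (fun i => u (Some i)) z0)) hD _ hR).
      by move=> u; rewrite /P optfK.
    case.
      by apply: dfun_sub hf1 => // u [h1 h2]; rewrite -(optfK u); exact: ab1.
    apply: (dfun_comp M0
      (t := fun u : option V -> M => optf (fun i => u (Some i)) z0)
      hD _ _ hf1) => [i|u [h1 _]]; last exact: ab1.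
    by apply: dfun_coord => //; case: i => [i|]; coordf_tac.
  exists a2, b2, v2; split=> // x abx; have [Ax nx] := k2 _ abx.
  have [|c [d [cdf h]]] := not_fat1_isolated M_dlo S_visceral _ nx (f (optf x z0)).
    exact: (dpred_fiber1 (P := fun x y => exists z, G x y z) x (dpred_ex hG)).
  have [p [q [pqx h']]] := c1 _ (ab1 _ _ abx abz0) c d cdf.
  have [e [g [egz k]]] := oo_itvI (pqx None) abz0.
  exists e, g, z0; split=> // z /k[pz az]; split=> //.
  have abz := ab1 _ _ abx az.
  apply: h; last by exists z.
  by apply: h' => // -[i|]; [exact: (pqx (Some i))|].
have sub3 x : box a3 b3 x -> box a2 b2 x by move=> /k3/(_ cdy3)[[]].
(* The variable z is frozen at z0, which leaves a map on a box with one coordinate fewer. *)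
have [|t [a' [b' [v' [tau [abv' htau ktau inj]]]]]] :=
    IH a3 b3 v3 (fun x => f (optf x z0)) abv3.
  apply: (dfun_comp M0 (t := fun x => optf x z0) (dpred_boxc M_dlo a3 b3) _ _ hf1).
    by move=> i; apply: dfun_coord; [exact: dpred_boxc|case: i; coordf_tac].
  by move=> x /sub3 abx; exact: ab1.
pose Bx := box (optf a' c3) (optf b' d3).
have hBx : dpred S Bx by exact: dpred_boxc.
have BxE u : Bx u -> box a' b' (fun i => u (Some i)) /\ (c3 < u None < d3)%O.
  by move=> h; split=> [i|]; [exact: (h (Some i))|exact: (h None)].
(* On the interval from c3 to d3 the value does not depend on z, so z becomes an additional free
   coordinate of the section. *)
exists t, (optf a' c3), (optf b' d3), (optf v' y3),
  (fun u => optf (tau (fun i => u (Some i))) (u None)); split.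
- exact: box_opt.
- case=> [j|]; last by apply: dfun_coord => //; coordf_tac.
  apply: (dfun_comp M0 (t := fun u i => u (Some i)) hBx _ _ (htau j))
    => [i|u /BxE[]//].
  by apply: dfun_coord => //; coordf_tac.
- move=> u /BxE[/ktau[ab3 ft] cdu]; have [[abt cdt] ->] := k3 _ _ ab3 cdu.
  by split=> //; apply: sub1; exact: ab1.
- move=> x y /BxE[abx _] /BxE[aby _] xy.
  have e i := congr1 (fun h => h i) xy.
  rewrite -(optfK x) -(optfK y) (e None : x None = y None).
  rewrite (inj _ _ abx aby)//; apply/funext => i; exact: (e (Some i)).
Qed.

(** By induction on W: on a fiber of one component of f there is an injective copy of a box with one
    dimension fewer, and the induction hypothesis applies to the remaining components there. *)
Lemma dim_drop_not_injective (W : finType) n (a b v : optn n -> M)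
    (f : (optn n -> M) -> W -> M) :
  (#|W| < n)%N -> box a b v -> (forall j, dfun S (box a b) (f^~ j)) ->
  exists x y, [/\ box a b x, box a b y, x <> y & f x = f y].
Proof.
have M0 := M_neq0 M_dlo.
elim/finType_option_ind: W n a b v f => [W W' g [h gK hK] IH n|[|n]|W IH [|n]]
  a b v f Wn abv hf.
- have WW : #|W| = #|W'| by apply: bij_eq_card; exists h.
  have [||x [y [abx aby xy fxy]]] := IH n a b v (fun x j => f x (g j)) _ abv.
  + by rewrite WW.
  + by move=> j; exact: hf.
  exists x, y; split=> //; apply/funext => j.
  by rewrite -(hK j); exact: (congr1 (fun k => k (h j)) fxy).
- by rewrite card_void in Wn.
(* With no component left any two points have the same image; v is moved in its coordinate [None] to
   get a second point. *)
- have /andP[av vb] := abv None; have [z /andP[vz zb]] := lt_mid M_dlo vb.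
  exists v, (optf (fun i => v (Some i)) z); split=> //.
  + by case=> [i|]; [exact: abv|rewrite /= zb (lt_trans av vz)].
  + move=> vz'; have /= e := congr1 (fun k => k None) vz'.
    by rewrite -e ltxx in vz.
  + by apply: fun_card0; exact: card_void.
- by rewrite ltn0 in Wn.
- have [t [a' [b' [v' [tau [abv' htau ktau inj]]]]]] := fiber_section abv (hf None).
  have [||x [y [abx aby xy fxy]]] :=
    IH n a' b' v' (fun x j => f (tau x) (Some j)) _ abv'.
  + by move: Wn; rewrite card_option.
  + move=> j; apply: (dfun_comp M0 (t := tau) (dpred_boxc M_dlo a' b') htau _
      (hf (Some j))) => x /ktau[] //.
  have [[abx' fx] [aby' fy]] := (ktau _ abx, ktau _ aby).
  exists (tau x), (tau y); split=> //; first by move/inj => /(_ abx aby).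
  apply/funext => -[j|]; last by rewrite fx fy.
  exact: (congr1 (fun k => k j) fxy).
Qed.

End dimension.

(** * Continuity expressed with boxes *)

Section continuity_on_boxes.
Context {disp : Order.disp_t} {M : orderTopologicalType disp}.
Context (M_dlo : dense_no_endpoints M).

Lemma contat_box (V : Type) (W : finType) (D : (V -> M) -> Prop)
    (F : (V -> M) -> W -> M) v c d :
  (forall j, contat D (F^~ j) v) -> box c d (F v) ->
  exists a b, box a b v /\ forall w, box a b w -> D w -> box c d (F w).
Proof.
move=> cF cdF.
suff h (s : seq W) : exists a b, box a b v /\ forall w, box a b w -> D w ->
    forall j, j \in s -> (c j < F w j < d j)%O.
  have [a [b [abv k]]] := h (enum W); exists a, b; split=> // w abw Dw j.
  by apply: k => //; rewrite mem_enum.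
elim: s => [|j s [a [b [abv k]]]].
  by have [a [b abv]] := box_ex M_dlo v; exists a, b.
have [a' [b' [abv' k']]] := cF j (c j) (d j) (cdF j).
have [p [q [pqv h]]] := box_meet abv abv'; exists p, q.
split=> // w /h[aw aw'] Dw i.
by rewrite inE => /predU1P[->|si]; [exact: k'|exact: k].
Qed.

(** Continuity of the coordinate projection s: the coordinates outside its image are bounded by an
    arbitrary box around u. *)
Lemma box_cylinder (V U : finType) (s : V -> U) (a b : V -> M) (u : U -> M) :
  injective s -> box a b (fun i => u (s i)) ->
  exists p q, box p q u /\ forall u', box p q u' -> box a b (fun i => u' (s i)).
Proof.
move=> sI abu; have [c [d cdu]] := box_ex M_dlo u.
exists (fun j => if [pick i | s i == j] is Some i then a i else c j),
  (fun j => if [pick i | s i == j] is Some i then b i else d j).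
split=> [j|u' h i].
  by case: pickP => [i /eqP<-|_]; [exact: abu|exact: cdu].
by have := h (s i); case: pickP => [i' /eqP/sI->//|/(_ i)]; rewrite eqxx.
Qed.

Lemma cvg_within_box n m (X : set 'rV[M]_n) (f : 'rV[M]_n -> 'rV[M]_m) x :
  (f @ within X (nbhs x) --> f x) <->
  (forall c d, box c d (f x ord0) -> exists a b, box a b (x ord0) /\
    forall y : 'rV[M]_n, box a b (y ord0) -> X y -> box c d (f y ord0)).
Proof.
split=> [h c d cdx|h A /(nbhs_box M_dlo)[c [d [/h[a [b [abx k]]] cdA]]]].
  have nb : nbhs (f x) [set y : 'rV[M]_m | box c d (y ord0)].
    by apply/(nbhs_box M_dlo); exists c, d.
  by have /(nbhs_box M_dlo)[a [b [abx k]]] := h _ nb; exists a, b.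
rewrite nbhs_filterE; apply/(nbhs_box M_dlo); exists a, b; split=> // y aby Xy.
by apply: cdA; exact: k.
Qed.

End continuity_on_boxes.

(** * Frontiers, discontinuities, and comparison with [topdim] *)

Section dimension_theorems.
Context {disp : Order.disp_t} {M : orderTopologicalType disp}.
Context {L : language} {S : fo_structure L M}.
Context (M_dlo : dense_no_endpoints M).
Context (S_visceral : locally_l_visceral S) (S_B : property_B S).
Context (S_d : property_d S) (S_cont : star_continuity S).

Definition frontier (U : Type) (P : (U -> M) -> Prop) (u : U -> M) : Prop :=
  (forall a b, box a b u -> exists2 w, P w & box a b w) /\ ~ P u.

Lemma dpred_frontier (U : finType) (P : (U -> M) -> Prop) :
  dpred S P -> dpred S (frontier P).
Proof.
move=> hP; have M0 := M_neq0 M_dlo.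
apply: dpred_and; last exact: dpred_not.
apply: (dpred_alls M0); apply: (dpred_alls M0); apply: dpred_imp.
  by apply: (dpred_box M_dlo); coordf_tac.
apply: (@dpred_ext _ _ _ _ _ (fun u : (U + U) + U -> M => exists w, P w /\
   box (fun i => u (inl (inr i))) (fun i => u (inr i)) w)).
  by move=> u; split=> [[w []]|[w]]; exists w.
apply: (dpred_exs M0); apply: dpred_and.
  by apply: (dpred_app hP); coordf_tac.
by apply: (dpred_box M_dlo); coordf_tac.
Qed.

(** Over a generic v, a frontier point has a box that misses the closed discrete fiber of P. Made
    uniform in v by (B), this box, restricted to the part over an open set, misses P but contains a
    point of its closure. *)
Lemma frontier_dim (U : finType) (P : (U -> M) -> Prop) d :
  dpred S P -> ~ has_dim P d.+1 -> ~ has_dim (frontier P) d.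
Proof.
move=> hP ndim [s [sI fY]]; have M0 := M_neq0 M_dlo.
pose V := 'I_d; have hY := dpred_frontier hP.
have hsY : dpred S (projp s (frontier P)).
  by apply: (dpred_projp M_dlo) hY _; coordf_tac.
have nb : ~ fat (bad_fiber s P).
  by apply: (bad_fiber_not_fat M_dlo S_visceral S_B) => //; rewrite card_ord.
have fE := fat_minus M_dlo S_visceral S_B hsY (dpred_bad_fiber M_dlo s hP) fY nb.
(* z holds the corners of a box that contains a frontier point over v and no point of P over v. *)
pose R (v : V -> M) (z : U + U -> M) :=
  (exists y, (frontier P y /\ forall i, y (s i) = v i) /\
    box (fun i => z (inl i)) (fun i => z (inr i)) y) /\
  forall x, P x -> (forall i, x (s i) = v i) ->
    ~ box (fun i => z (inl i)) (fun i => z (inr i)) x.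
have hR : dpred S (fun u : V + (U + U) -> M =>
    R (fun i => u (inl i)) (fun j => u (inr j))).
  apply: dpred_and.
    apply: (dpred_exs M0); apply: dpred_and; last first.
      by apply: (dpred_box M_dlo); coordf_tac.
    apply: dpred_and; first by apply: (dpred_app hY); coordf_tac.
    by apply: (dpred_allfin M0) => i; apply: dpred_eq; coordf_tac.
  apply: (dpred_alls M0); apply: dpred_imp.
    by apply: (dpred_app hP); coordf_tac.
  apply: dpred_imp.
    by apply: (dpred_allfin M0) => i; apply: dpred_eq; coordf_tac.
  by apply: dpred_not; apply: (dpred_box M_dlo); coordf_tac.
have fR : fat (fun v => fat (R v)).
  apply: fat_sub fE => v [[y Yy ys] nbv].
  have [c [e [cey h]]] := not_bad_locfin M_dlo S_visceral hP nbv y.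
  apply: (fat_corners M_dlo cey) => z bz sub; split; first by exists y.
  move=> x Px xs /sub bx; have xy := h x bx (conj Px xs).
  by case: Yy => _; rewrite -xy.
have /fat_sum[a [b [v [c [e [z [abv cez k]]]]]]] := fat_fiber M_dlo S_B hR fR.
have [[y [[[cl _] ys] by_]] _] := k _ _ abv cez.
have [|p [q [pqy hpq]]] := @box_cylinder _ _ M_dlo _ _ s a b y sI.
  by move=> i; rewrite ys.
have [a' [b' [aby h]]] := box_meet by_ pqy.
(* Closure supplies a point x of P in the box and over the open set; this contradicts the second
   clause of R at the projection of x. *)
have [x Px /h[bx /hpq abx]] := cl _ _ aby.
by have [_ /(_ x Px (fun=> erefl))] := k _ _ abx cez.
Qed.

Definition discont (U W : Type) (P : (U -> M) -> Prop)
    (f : (U -> M) -> W -> M) (u : U -> M) : Prop :=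
  P u /\ ~ forall c d, box c d (f u) -> exists a b, box a b u /\
    forall w, box a b w -> P w -> box c d (f w).

Lemma dpred_discont (U W : finType) (P : (U -> M) -> Prop)
    (f : (U -> M) -> W -> M) :
  dpred S P -> (forall j, dfun S P (f^~ j)) -> dpred S (discont P f).
Proof.
move=> hP hf; have M0 := M_neq0 M_dlo.
(* Joining [P u] to the condition on [f u] keeps f within its domain, so K is definable; z holds
   both corners. *)
pose K (u : U -> M) (z : W + W -> M) :=
  P u /\ box (fun j => z (inl j)) (fun j => z (inr j)) (f u).
have hK : dpred S (fun x : U + (W + W) -> M =>
    K (fun i => x (inl i)) (fun j => x (inr j))).
  pose D (x : U + (W + W) -> M) := P (fun i => x (inl i)).
  have hD : dpred S D by apply: (dpred_app hP); coordf_tac.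
  have hR : dpred S (fun y : (W + W) + W -> M =>
      box (fun j => y (inl (inl j))) (fun j => y (inl (inr j)))
        (fun j => y (inr j))).
    by apply: (dpred_box M_dlo); coordf_tac.
  apply: (dpred_comp M0 (t := fun x => sumf (fun j => x (inr j))
    (f (fun i => x (inl i)))) hD _ hR) => -[j|j].
    by apply: dfun_coord => //; coordf_tac.
  apply: (dfun_comp M0 (t := fun x i => x (inl i)) hD _ _ (hf j)) => // i.
  by apply: dfun_coord => //; coordf_tac.
apply: (@dpred_ext _ _ _ _ _ (fun u => P u /\ ~ forall z : W + W -> M, K u z ->
  exists a b, box a b u /\ forall w, box a b w -> P w -> K w z)).
  move=> u; split=> -[Pu n]; split=> // h; apply: n.
    move=> z [_ /h[a [b [abu k]]]]; exists a, b; split=> // w abw Pw.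
    by split=> //; exact: k.
  move=> c d cdu; have [|a [b [abu k]]] := h (sumf c d); first by split.
  by exists a, b; split=> // w abw /(k _ abw)[].
apply: dpred_and => //; apply: dpred_not; apply: (dpred_alls M0).
apply: dpred_imp => //.
apply: (dpred_exs M0); apply: (dpred_exs M0); apply: dpred_and.
  by apply: (dpred_box M_dlo); coordf_tac.
apply: (dpred_alls M0); apply: dpred_imp.
  by apply: (dpred_box M_dlo); coordf_tac.
apply: dpred_imp; first by apply: (dpred_app hP); coordf_tac.
apply: (dpred_app (t := fun u x => match x with
  inl i => u (inr i) | inr j => u (inl (inl (inl (inr j)))) end) hK).
by coordf_tac.
Qed.

(** Otherwise a continuous section tau of the discontinuity set exists whose image is relatively
    open in P; f is then continuous at a point of that image where f o tau is continuous. *)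
Lemma discont_dim (U W : finType) (P : (U -> M) -> Prop)
    (f : (U -> M) -> W -> M) d :
  dpred S P -> (forall j, dfun S P (f^~ j)) ->
  ~ has_dim P d.+1 -> ~ has_dim (discont P f) d.
Proof.
move=> hP hf ndim [s [sI fQ]]; have M0 := M_neq0 M_dlo.
have [||a [b [v0 [tau [c [e [abv0 htau ctau ktau iso]]]]]]] :=
  local_section M_dlo S_visceral S_B S_d S_cont hP (dpred_discont hP hf) _ sI _ fQ.
- by move=> u [].
- by rewrite card_ord.
have Ptau v : box a b v -> P (tau v) by move=> /ktau[[]].
have [|a1 [b1 [v1 [abv1 sub1 c1]]]] :=
    continuous_subbox M_dlo S_cont (f := fun v => f (tau v)) abv0.
  move=> j; exact: (dfun_comp M0 (t := tau) (dpred_boxc M_dlo a b) htau Ptau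
    (hf j)).
have [[_ nc] tau_s btau] := ktau _ (sub1 _ abv1).
apply: nc => p q pqf.
have [a2 [b2 [abv2 k2]]] := contat_box M_dlo (fun j => c1 _ j abv1) pqf.
have [a3 [b3 [abv3 k3]]] := box_meet abv1 abv2.
have [|a4 [b4 [abv4 k4]]] := @box_cylinder _ _ M_dlo _ _ s a3 b3 (tau v1) sI.
  by move=> i; rewrite tau_s.
have [a5 [b5 [abv5 k5]]] := box_meet btau abv4.
exists a5, b5; split=> // w /k5[bw /k4/k3[abw abw2]] Pw.
(* Near [tau v1] each w in P is tau of its own projection, so [f w] is a value of f o tau. *)
by rewrite (iso w Pw bw (sub1 _ abw)); exact: k2.
Qed.

Lemma not_injective (V W : finType) (a b v : V -> M) (f : (V -> M) -> W -> M) :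
  (#|W| < #|V|)%N -> box a b v -> (forall j, dfun S (box a b) (f^~ j)) ->
  exists x y, [/\ box a b x, box a b y, x <> y & f x = f y].
Proof.
move=> WV abv hf; have M0 := M_neq0 M_dlo.
have [g [h gK hK]] := bij_card (esym (card_optn #|V|)).
pose A i := a (h i); pose B i := b (h i).
have hbox x : box A B x -> box a b (fun i => x (g i)).
  by move=> bx i; have := bx (g i); rewrite /A /B gK.
have [||x [y [bx by_ xy fxy]]] := dim_drop_not_injective M_dlo S_visceral S_B S_d
  S_cont (a := A) (b := B) (v := fun i => v (h i))
  (f := fun x => f (fun i => x (g i))) WV.
- by move=> i; exact: abv.
- move=> j; apply: (dfun_comp M0 (t := fun x i => x (g i)) (dpred_boxc M_dlo A B) _
    hbox (hf j)) => i.
  by apply: dfun_coord; [exact: dpred_boxc|coordf_tac].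
exists (fun i => x (g i)), (fun i => y (g i)).
split; [exact: hbox|exact: hbox| |by []].
move=> e; apply: xy; apply/funext => i.
by rewrite -(hK i); exact: (congr1 (fun k => k (h i)) e).
Qed.

(** Increasing and merely injective choices of coordinates give the same notion, since permuting
    coordinates preserves interior. *)
Lemma proj_interior_dim n (X : set 'rV[M]_n) e :
  proj_interior X e <-> has_dim (pred_of X) e.
Proof.
split=> [[s sinc /(interior_fat M_dlo) fX]|[s [sI fX]]].
  exists s; split.
    move=> i j sij; apply: val_inj; case: (ltngtP i j) => // /sinc;
    by rewrite sij ltnn.
  apply: fat_sub fX => v [x Xx xv]; exists (x ord0) => [|i].
    by rewrite /pred_of row_fun.
  by have /rowP/(_ i) := xv; rewrite !mxE.
pose A := [set s i | i : 'I_e]%SET.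
have cA : #|A| = e by rewrite card_imset// card_ord.
(* s' lists the image of s in increasing order; g below is the permutation that relates it to s. *)
pose s' (i : 'I_e) : 'I_n := @Order.enum_val _ _ A (cast_ord (esym cA) i).
have s'inc : coord_choice s'.
  move=> i j ij; have : (s' i < s' j)%O; last by rewrite ltEord.
  by rewrite /s' (leW_mono (@Order.le_enum_val _ _ (@le_total _ 'I_n) (mem A)))
    ltEord.
exists s' => //; apply/(interior_fat M_dlo).
have s's i : exists j, s j = s' i.
  have : s' i \in A by exact: Order.enum_valP.
  by case/imsetP => j _ ->; exists j.
have [g gP] := choice s's.
have gI : injective g.
  move=> i j gij; have := gP i; rewrite gij gP => sij.
  apply: val_inj; case: (ltngtP i j) => // /s'inc; by rewrite sij ltnn.
have [h gK hK] := injF_bij gI.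
apply: fat_sub (fat_ren hK fX) => v [u Xu us].
exists (\row_i u i)%R => //; apply/rowP => i.
by rewrite !mxE -gP us gK.
Qed.

Lemma has_dim_leq n (X : set 'rV[M]_n) e : has_dim (pred_of X) e -> (e <= n)%N.
Proof. by move=> [s [/leq_card]]; rewrite !card_ord. Qed.

Lemma topdimP n (X : set 'rV[M]_n) : X !=set0 -> exists d,
  [/\ topdim X = (d%:Z)%:E, has_dim (pred_of X) d
    & forall e, has_dim (pred_of X) e -> (e <= d)%N].
Proof.
move=> X0; rewrite /topdim; case: asboolP => // _.
eexists; split; first by [].
(* The index 0 qualifies since X is nonempty, so the maximum is attained by a genuine projection. *)
- have [x Xx] := X0; have P0 : `[< proj_interior X (@ord0 n) >].
    apply/asboolP/proj_interior_dim/(has_dim0 M_dlo (u := x ord0)).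
    by rewrite /pred_of row_fun.
  rewrite (@bigop.bigmax_eq_arg _ ord0 (fun i : 'I_n.+1 => `[< proj_interior X i >])
    (fun i => i : nat) P0); case: arg_maxnP => // i /asboolP + _.
  by move/proj_interior_dim.
- move=> e he; have en : (e < n.+1)%N by rewrite ltnS (has_dim_leq he).
  apply: (@leq_bigmax_cond _ _ (fun i : 'I_n.+1 => i : nat) (Ordinal en)).
  exact/asboolP/proj_interior_dim.
Qed.

(** The hypothesis is applied with d the dimension of X. An empty Y is covered by the value
    [-oo]. *)
Lemma topdim_lt n (X Y : set 'rV[M]_n) : X !=set0 ->
  (forall d, ~ has_dim (pred_of X) d.+1 -> ~ has_dim (pred_of Y) d) ->
  (topdim Y < topdim X)%E.
Proof.
move=> X0 h; have [d [-> hd maxd]] := topdimP X0.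
have [Y0|Y0] := pselect (Y !=set0); last first.
  by rewrite /topdim; case: asboolP => //; rewrite ltNyr.
have [e [-> he maxe]] := topdimP Y0; rewrite lte_fin ltz_nat ltnNge.
apply/negP => de; apply: (h d); last exact: has_dim_le he.
by move/maxd; rewrite ltnn.
Qed.

Lemma topdim_eq n (X Y : set 'rV[M]_n) d : topdim X = (d%:Z)%:E ->
  X !=set0 -> Y `<=` X -> has_dim (pred_of Y) d -> topdim Y = topdim X.
Proof.
move=> Xd X0 YX hY; have Y0 : Y !=set0.
  by have [s [_ /fat_ex[v [u Yu _]]]] := hY; eexists; exact: Yu.
have [d' [Xd' _ maxd]] := topdimP X0; have [e [-> he maxe]] := topdimP Y0.
move: Xd; rewrite Xd' => -[dd']; subst d'; congr (_%:Z)%:E.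
apply/eqP; rewrite eqn_leq (maxe _ hY) andbT; apply: maxd.
by apply: has_dim_sub he => v; exact: YX.
Qed.

End dimension_theorems.

(** * The four statements for definable subsets of M^n *)

Section main.
Context {disp : Order.disp_t} {M : orderTopologicalType disp}.
Context {L : language} {S : fo_structure L M}.
Context (M_dlo : dense_no_endpoints M).
Context (S_visceral : locally_l_visceral S) (S_B : property_B S).
Context (S_d : property_d S) (S_cont : star_continuity S).

Lemma topdim_discontinuities n m (X : set 'rV[M]_n)
    (f : 'rV[M]_n -> 'rV[M]_m) :
  definable S X -> X !=set0 -> definable_map S X f ->
  (topdim (discontinuities X f) < topdim X)%E.
Proof.
move=> /definable_pred hX X0 hf; apply: (topdim_lt M_dlo) => // d ndim hd.
apply: (discont_dim M_dlo S_visceral S_B S_d S_cont hX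
  (dfun_definable_map M_dlo hf) ndim).
apply: has_dim_sub hd => v [Xv nc]; split=> // h; apply: nc.
apply/(cvg_within_box M_dlo) => a b abf.
have [p [q [pqv k]]] := h a b abf.
exists p, q; rewrite fun_row; split=> // y pqy Xy.
by have := k _ pqy; rewrite /pred_of row_fun; exact.
Qed.

Lemma topdim_frontier n (X : set 'rV[M]_n) :
  definable S X -> X !=set0 -> (topdim (closure X `\` X) < topdim X)%E.
Proof.
move=> /definable_pred hX X0; apply: (topdim_lt M_dlo) => // d ndim hd.
apply: (frontier_dim M_dlo S_visceral S_B hX ndim).
apply: has_dim_sub hd => v [clv nX]; split=> // a b abv.
have [|y [Xy aby]] := clv [set y : 'rV[M]_n | box a b (y ord0)].
  by apply/(nbhs_box M_dlo); exists a, b; rewrite fun_row.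
by exists (y ord0) => //; rewrite /pred_of row_fun.
Qed.

(** A continuous local section of X is the embedding, and the coordinate projection is its
    continuous inverse. *)
Lemma embeds_box_dim n (X : set 'rV[M]_n) d :
  definable S X -> has_dim (pred_of X) d -> ~ has_dim (pred_of X) d.+1 ->
  embeds_box S X d.
Proof.
move=> /definable_pred hX [s [sI fX]] ndim.
have [||a [b [v0 [tau [c [e [abv0 htau ctau ktau iso]]]]]]] :=
  local_section M_dlo S_visceral S_B S_d S_cont hX hX _ sI _ fX.
- by [].
- by rewrite card_ord.
pose B := [set x : 'rV[M]_d | box a b (x ord0)].
pose f (x : 'rV[M]_d) : 'rV[M]_n := (\row_i tau (x ord0) i)%R.
have fs x : B x -> colsub s (f x) = x.
  by move=> /ktau[_ ts _]; apply/rowP => i; rewrite !mxE.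
have BE v : pred_of B v <-> box a b v by rewrite /pred_of /B/= fun_row.
exists B, f; split.
- exact: box_open_box.
- by exists (\row_i v0 i)%R; rewrite /B/= fun_row.
- apply: (definable_map_dfun M_dlo).
    by apply: dpred_ext (dpred_boxc M_dlo a b) => v; rewrite BE.
  move=> j; apply: dpred_ext (htau j) => u.
  by rewrite BE /f mxE fun_row.
- by move=> _ [x /ktau[Xt _ _] <-].
split; first by move=> x y /set_mem/fs {2}<- /set_mem/fs {2}<- ->.
split.
  apply/subspace_continuousP => x Bx; apply/(cvg_within_box M_dlo) => p q pqf.
  have [] := contat_box M_dlo (fun j => ctau (x ord0) j Bx) (c := p) (d := q).
    by move: pqf; rewrite /f fun_row.
  move=> a' [b' [abx k]]; exists a', b'; split=> // y aby By.
  by rewrite /f fun_row; exact: k.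
exists (colsub s); split; first by move=> x /set_mem; exact: fs.
apply/subspace_continuousP => y _; apply/(cvg_within_box M_dlo) => p q pqy.
have sy (z : 'rV[M]_n) : colsub s z ord0 = (fun i => z ord0 (s i)).
  by apply/funext => i; rewrite mxE.
have [|p' [q' [pq' k]]] := @box_cylinder _ _ M_dlo _ _ s p q (y ord0) sI.
  by rewrite -sy.
by exists p', q'; split=> // z /k; rewrite sy.
Qed.

(** Let d' be the dimension of the image Y, so d' is at most d. On an open part of Y a point is
    determined by d' coordinates, so if d' < e these coordinates of f would form an injective
    definable map from a box of M^e to M^d', against [not_injective]. *)
Lemma dim_embeds_box n (X : set 'rV[M]_n) d e :
  (forall k, has_dim (pred_of X) k -> (k <= d)%N) ->
  embeds_box S X e -> (e <= d)%N.
Proof.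
move=> maxd [B [f [oB [x1 Bx1] hf fBX [finj [cf _]]]]].
have M0 := M_neq0 M_dlo.
pose Y := f @` B.
have hdf := dfun_definable_map M_dlo hf.
have hY : dpred S (pred_of Y).
  have /definable_pred hG := hf.
  apply: (@dpred_ext _ _ _ _ _ (fun v => exists x : 'I_e -> M,
    pred_of [set row_mx x (f x) | x in B]
      (fun k => match fintype.split k with inl i => x i | inr j => v j end))).
    move=> v; rewrite /pred_of; split=> [[x]|[x Bx xv]].
      by rewrite -row_mx_fun => -[z Bz /eq_row_mx[_ fz]]; exists z.
    by exists (x ord0); rewrite -row_mx_fun row_fun; exists x => //; rewrite xv.
  apply: (dpred_exs M0).
  apply: (dpred_app (t := fun u k => match fintype.split k with
    inl i => u (inr i) | inr j => u (inl j) end) hG) => k.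
  by case: fintype.split; coordf_tac.
have Y0 : Y !=set0 by exists (f x1), x1.
have [d' [_ [s [sI fY]] maxd']] := topdimP M_dlo Y0.
have d'd : (d' <= d)%N.
  by apply: maxd; apply: (@has_dim_sub _ _ _ (pred_of Y)) => [v /fBX|]//; exists s.
apply: leq_trans d'd; rewrite leqNgt; apply/negP => d'e.
have [||a [b [v0 [tau [c [g [abv0 htau ctau ktau iso]]]]]]] :=
  local_section M_dlo S_visceral S_B S_d S_cont hY hY _ sI _ fY.
- by [].
- by rewrite card_ord => /maxd'; rewrite ltnn.
have [[x0 Bx0 fx0] tau_s bt] := ktau _ abv0.
have fx0' : f x0 ord0 = tau v0 by rewrite fx0 fun_row.
have [|p [q [pqt kpq]]] := @box_cylinder _ _ M_dlo _ _ s a b (tau v0) sI.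
  by rewrite (_ : (fun i => _) = v0)//; exact/funext.
have [c1 [g1 [cgt kcg]]] := box_meet bt pqt.
have /subspace_continuousP/(_ _ Bx0)/(cvg_within_box M_dlo)/(_ c1 g1) := cf.
rewrite fx0' => /(_ cgt)[a1 [b1 [abx0 k1]]].
have [a2 [b2 [abx2 k2]]] := open_box_nbhs M_dlo oB Bx0.
have [a3 [b3 [abx3 k3]]] := box_meet abx0 abx2.
(* By continuity, f maps a small box around x0 into the region where tau describes Y. *)
have good x : box a3 b3 x -> [/\ B (\row_i x i)%R,
    box c g (f (\row_i x i)%R ord0)
    & box a b (fun i => f (\row_i x i)%R ord0 (s i))].
  move=> /k3[ab1 ab2]; have Bx : B (\row_i x i)%R by apply: k2; rewrite fun_row.
  have [|bc bp] := kcg (f (\row_i x i)%R ord0); last by split=> //; exact: kpq.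
  by apply: k1 => //; rewrite fun_row.
have [||x [y [bx by_ xy fxy]]] := not_injective M_dlo S_visceral S_B S_d S_cont
  (a := a3) (b := b3) (v := x0 ord0)
  (f := fun x (i : 'I_d') => f (\row_i x i)%R ord0 (s i)) _ abx3.
- by rewrite !card_ord.
- move=> i; apply: dfun_sub (hdf (s i)) => [|z /good[]//].
  exact: dpred_boxc.
have [Bx cx sx] := good _ bx; have [By cy sy] := good _ by_.
have Yf z : B (\row_i z i)%R -> pred_of Y (f (\row_i z i)%R ord0).
  by move=> Bz; rewrite /pred_of row_fun; exists (\row_i z i)%R.
(* Both values of f are recovered from their coordinates s, which agree; injectivity of f then
   contradicts [xy]. *)
have ex := iso _ (Yf _ Bx) cx sx; have ey := iso _ (Yf _ By) cy sy.
apply: xy; rewrite -[x]fun_row -[y]fun_row; congr (fun_of_matrix _ ord0).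
apply: finj; [exact: mem_set|exact: mem_set|].
by rewrite -[LHS]row_fun -[RHS]row_fun ex ey fxy.
Qed.

(** The point is a value of a continuous local section: every box around it contains the image of a
    smaller box of M^d, and this image projects back onto that box. *)
Lemma topdim_local n (X : set 'rV[M]_n) : definable S X -> X !=set0 ->
  exists x, X x /\ forall B : set 'rV[M]_n, open_box B -> B x ->
    topdim (X `&` B) = topdim X.
Proof.
move=> /definable_pred hX X0.
have [d [Xd [s [sI fX]] maxd]] := topdimP M_dlo X0.
have [||a [b [v0 [tau [c [e [abv0 htau ctau ktau iso]]]]]]] :=
  local_section M_dlo S_visceral S_B S_d S_cont hX hX _ sI _ fX.
- by [].
- by rewrite card_ord => /maxd; rewrite ltnn.
have [Xt _ _] := ktau _ abv0.
exists (\row_i tau v0 i)%R; split=> // B oB /(open_box_nbhs M_dlo oB).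
rewrite fun_row => -[p [q [pqt k]]].
apply: (topdim_eq M_dlo Xd X0); first by move=> x [].
have [a1 [b1 [abv1 k1]]] := contat_box M_dlo (fun j => ctau v0 j abv0) pqt.
have [a2 [b2 [abv2 k2]]] := box_meet abv0 abv1.
exists s; split=> //; exists a2, b2, v0; split=> // v /k2[abv ab1v].
have [Xv sv _] := ktau _ abv; exists (tau v) => //; split=> //.
by apply: k; rewrite fun_row; exact: k1.
Qed.

Lemma topdim_embeds_box n (X : set 'rV[M]_n) d :
  definable S X -> X !=set0 ->
  topdim X = (d%:Z)%:E <-> is_max_nat (embeds_box S X) d.
Proof.
move=> dX X0; have [k [-> hk maxk]] := topdimP M_dlo X0.
have ek : embeds_box S X k.
  by apply: embeds_box_dim => //; move/maxk; rewrite ltnn.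
split=> [[<-]|[ed maxd]]; first by split=> // e; exact: dim_embeds_box.
congr (_%:Z)%:E; apply/eqP; rewrite eqn_leq maxd//=.
exact: dim_embeds_box ed.
Qed.

End main.

Theorem theorem4p22 (disp : Order.disp_t) (M : orderTopologicalType disp)
    (L : language) (S : fo_structure L M)
    (M_dlo : dense_no_endpoints M)
    (S_visceral : locally_l_visceral S)
    (S_d : property_d S)
    (S_B : property_B S)
    (S_cont : star_continuity S)
    (n : nat) (X : set 'rV[M]_n) (X_def : definable S X) (X_neq0 : X !=set0) :
  [/\ forall (m : nat) (f : 'rV[M]_n -> 'rV[M]_m), definable_map S X f ->
        (topdim (discontinuities X f) < topdim X)%E,
      (topdim (closure X `\` X) < topdim X)%E,
      forall d : nat, topdim X = (d%:Z)%:E <-> is_max_nat (embeds_box S X) d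
    & exists x, X x /\
        forall B : set 'rV[M]_n, open_box B -> B x -> topdim (X `&` B) = topdim X].
Proof.
split.
- by move=> m f; exact: (topdim_discontinuities M_dlo).
- exact: (topdim_frontier M_dlo S_visceral S_B).
- by move=> d; exact: topdim_embeds_box.
- exact: (topdim_local M_dlo S_visceral S_B S_d S_cont).
Qed.
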